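(* Let $K=K(d)$ be a function of the integer $d\ge 2$ with values in the positive integers, let $m_0=m_0(d)=\frac{\sqrt d}{\log^2 d}$, and let $f$ be a random polynomial from $\mathcal P_{d,K}$ with independent and uniformly distributed coefficients. (1) If $K\le d^{a-1}$ for some natural number $a>1$, then, in the limit as $d\to\infty$, the probability that $f$ is divisible by at least one polynomial with integer coefficients of positive degree not exceeding $m_0$ is at most $O\left(\sqrt{\frac Kd}\right)$. (2) If $cd\le K\le d^{a-1}$, where $c>0$ is a constant and $a>1$ is a natural number, then the probability that $f$ is divisible by at least one polynomial with integer coefficients of positive degree not exceeding $m_0$ is at most $O\left(\frac1K\right)$ as $d\to\infty$.
   Context: For $d,K\in\mathbb N$, $\mathcal P_{d,K}$ is the set of polynomials $f(x)=x^d+a_{d-1}x^{d-1}+\dots+a_1x+a_0$ with $a_0\neq 0$ and $a_i\in[-K,K]\cap\mathbb Z$ for all $0\le i\le d-1$. ''Independent and uniformly distributed coefficients'' means that $a_0,\dots,a_{d-1}$ are independent, each uniform on its set of allowed values (equivalently, $f$ is uniform on $\mathcal P_{d,K}$). Divisibility is in $\mathbb Z[x]$; $\log$ is the natural logarithm and $\log^2 d=(\log d)^2$. The implied constants may depend on the constants $a$ and $c$. *)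

(* Defs.v *)
From mathcomp Require Export all_boot all_order all_algebra finmap.
From mathcomp Require Export all_classical all_reals all_analysis.
Export Order.TTheory GRing.Theory Num.Theory.
Export numFieldNormedType.Exports.

#[export] Set Implicit Arguments.
#[export] Unset Strict Implicit.
#[export] Unset Printing Implicit Defensive.

Local Open Scope classical_set_scope.
Local Open Scope ring_scope.

Definition allowed (K i : nat) : set int :=
  [set v | `|v| <= K%:Z /\ (i = 0%N -> v != 0)].

Definition polyPdK (d K : nat) : set {poly int} :=
  [set f | f \is monic /\ size f = d.+1 /\
           forall i, (i < d)%N -> allowed K i f`_i].

(* The type int carries the discrete sigma-algebra, in which every B : set int
   is measurable. *)
Definition discrete_RV disp (T : measurableType disp) (X : T -> int) : Prop :=
  forall B : set int, measurable (X @^-1` B).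

Definition independent_RVs disp (T : measurableType disp) (R : realType)
    (P : probability T R) (n : nat) (X : 'I_n -> T -> int) : Prop :=
  forall (J : {set 'I_n}) (B : 'I_n -> set int),
    P [set w | forall i, i \in J -> B i (X i w)] =
    (\prod_(i in J) P (X i @^-1` B i))%E.

(* S is meant to be finite: fset_set sends an infinite set to fset0. *)
Definition uniform_on disp (T : measurableType disp) (R : realType)
    (P : probability T R) (S : set int) (X : T -> int) : Prop :=
  forall v, S v -> P (X @^-1` [set v]) = ((#|` fset_set S|%:R)^-1 : R)%:E.

Definition random_poly disp (T : measurableType disp) (R : realType)
    (P : probability T R) (d K : nat) (f : T -> {poly int}) : Prop :=
  let a (i : 'I_d) (w : T) := (f w)`_i in
  [/\ forall w, polyPdK d K (f w),
      forall i, discrete_RV (a i),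
      independent_RVs P a
    & forall i : 'I_d, uniform_on P (allowed K i) (a i)].

(* Divisibility in Z[x]. The library's p %| q on {poly int} is pseudo-division,
   i.e. divisibility in Q[x]. *)
Definition dvdZX (g f : {poly int}) : Prop := exists q, f = q * g.

Definition m0 (R : realType) (d : nat) : R :=
  Num.sqrt d%:R / ln (d%:R : R) ^+ 2.

(* For g != 0, the degree of g is (size g).-1. *)
Definition has_divisor_deg_le (R : realType) (m : R) (f : {poly int}) : Prop :=
  exists g : {poly int},
    [/\ (0 < (size g).-1)%N, (size g).-1%:R <= m & dvdZX g f].

(* Main.v *)
Require Import Defs.
From mathcomp Require Import all_fingroup all_field spectral.
From mathcomp Require Import zify ring lra.

(** A divisor of small degree of f has a root alpha which is an algebraic integer
    of degree n <= m0 = sqrt d / log^2 d.  Let zs be the set of its conjugates and M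
    the product of the max(1, |z|), its Mahler measure.  The reason why f(alpha) = 0
    is unlikely depends on whether alpha is a root of unity.

    Roots of unity ([card_bad_le_inv_K], [card_bad_le_inv_sqrt]).  A primitive r-th
    root of unity has degree n = phi(r), hence r <= 2 n^2 and there are at most about
    2 n^2 candidates of degree n.  Given the other coefficients of f, the n lowest ones
    are determined by f(alpha) = 0, so that this event has probability at most
    (2K)^-n.  The sum over n of n^2 (2K)^-n is O(1/K), which is the bound (2).  For
    the bound (1), f(alpha) = 0 also determines the sum of the coefficients of index
    divisible by r and, if n >= 2, the sum of those of index 1 modulo r.  A sum of N
    independent uniform variables takes a given value with probability O(N^(-1/2)),
    which gives O(sqrt (r/d)) for each r, and O(r/d) if n >= 2.  This is summed over
    n = O(log d); for larger n the factor 2^-n suffices.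

    Other roots.  Their contribution is smaller than any power of d.  Choose u least
    such that M^(2^(u+1)) exceeds 4 d K^2.
    - By Landau's inequality a nonzero integer polynomial vanishing on zs has
      Euclidean norm at least M.  Applied to the repeated squares of the conjugates,
      it shows that about d / 2^(u+1) coefficients of f are determined by the others
      ([rigid_exists]), so each zs has probability at most 2^-(d/2^(u+1)).
    - The set zs is determined by its power sums s_k, k < 2n, which are integers of
      absolute value at most n M^(2n).  Hence there are at most
      exp(O(n log d + n^2 log d / 2^u)) sets zs at level u ([card_level_le]).
      Counting by coefficients would give exp(O(n^2)), which is too large.
    - The exponent u is not too large, because M^(4X) >= 2 for some X = O(n log d)
      ([mahler_ge_of_primes]).  To see this take a suitable prime p >= 4n and the
      Vandermonde determinant V of the numbers z and z^p.  The polynomial g whose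
      roots are the z satisfies g(x^p) = g(x)^p modulo p, so that each g(z^p) is divisible by p, V^2
      is a nonzero integer multiple of p^(2n), while Hadamard's inequality bounds it
      by (2n)^(2n) M^(4n(p+1)).
    Since n^2 (log d)^4 = O(d), the product of the two bounds is tiny. *)

Local Open Scope ring_scope.

(** * Mahler measure and Landau's inequality *)

Section Landau.
Variable C : numClosedFieldType.
Implicit Types (z w : C) (zs ws : seq C).

Local Notation toC := (map_poly (intr : int -> C)).

Definition mahler1 (z : C) : C := if 1 <= `|z| then `|z| else 1.

(** The Mahler measure of the monic polynomial with roots [zs]. *)
Definition mahler (zs : seq C) : C := \prod_(z <- zs) mahler1 z.

Lemma mahler1_ge1 z : 1 <= mahler1 z.
Proof. by rewrite /mahler1; case: ifP. Qed.

Lemma norm_le_mahler1 z : `|z| <= mahler1 z.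
Proof.
rewrite /mahler1; case: ifP => // /negbT.
by rewrite real_leNgt ?rpred1 ?normr_real // negbK; exact: ltW.
Qed.

Lemma mahler_ge1 zs : 1 <= mahler zs.
Proof.
rewrite /mahler; elim: zs => [|z zs IH]; first by rewrite big_nil.
rewrite big_cons; apply: mulr_ege1; [exact: mahler1_ge1|exact: IH].
Qed.

Definition sqnorm (N : nat) (p : {poly C}) : C := \sum_(i < N) `|p`_i| ^+ 2.

(** The factors X - w and 1 - w^* X have the same absolute value on the unit
    circle, so exchanging them preserves the Euclidean norm of the coefficients.  In
    coefficients, the two sides differ by a telescoping sum. *)
Lemma sqnorm_swap (N : nat) (w : C) (u : {poly C}) : (size u <= N)%N ->
  sqnorm N.+1 (('X - w%:P) * u) = sqnorm N.+1 ((1 - (w^*) *: 'X) * u).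
Proof.
move=> su.
have T : \sum_(i < N.+1) `|('X * u)`_i| ^+ 2 = \sum_(i < N.+1) `|u`_i| ^+ 2.
  rewrite big_ord_recl coefXM /= normr0 expr0n add0r.
  rewrite big_ord_recr /= (nth_default 0 su) normr0 expr0n addr0.
  by apply: eq_bigr => i _; rewrite coefXM.
set SX := \sum_(i < N.+1) _ in T; set SU := \sum_(i < N.+1) _ in T.
have -> : sqnorm N.+1 (('X - w%:P) * u) =
    sqnorm N.+1 (('X - w%:P) * u) + (`|w| ^+ 2 * SX + SU) - (`|w| ^+ 2 * SU + SX).
  by rewrite T addrK.
apply/eqP; rewrite subr_eq; apply/eqP.
rewrite /sqnorm /SX /SU !mulr_sumr -!big_split /=; apply: eq_bigr => i _.
rewrite !mulrBl !coefB mul1r coefCM -(scalerAl w^* _ u) coefZ.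
set a := ('X * u)`_i; set b := u`_i.
rewrite !normCK !rmorphB !rmorphM /= conjCK.
ring.
Qed.

(** Replacing X - w by 1 - w^* X for each root outside the unit disc does not change
    the norm, and multiplies the leading coefficient by the Mahler measure. *)
Lemma landau_aux (ws : seq C) (N : nat) (u : {poly C}) :
  (size u <= N.+1)%N ->
  `|u`_N| ^+ 2 * mahler ws ^+ 2
    <= sqnorm (N + size ws).+1 (\prod_(w <- ws) ('X - w%:P) * u).
Proof.
elim: ws N u => [|w ws IH] N u su.
  rewrite /mahler !big_nil expr1n mulr1 mul1r addn0 /sqnorm big_ord_recr /=.
  by rewrite lerDr sumr_ge0 // => i _; rewrite exprn_ge0.
have szX (q : {poly C}) : (size q <= 2)%N -> (size (q * u)%R <= N.+2)%N.
  by move=> sq; apply: leq_trans (size_polyMleq _ _) _; lia.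
have unext : u`_N.+1 = 0 by apply: nth_default.
rewrite /mahler !big_cons -/(mahler ws) /mahler1 /= addnS -addSn exprMn.
case: ifP => w1.
- have -> : sqnorm (N.+1 + size ws).+1 (('X - w%:P) * \prod_(z <- ws) ('X - z%:P) * u)
          = sqnorm (N.+1 + size ws).+1
              (\prod_(z <- ws) ('X - z%:P) * ((1 - (w^*) *: 'X) * u)).
    rewrite -mulrA sqnorm_swap; first by rewrite mulrCA.
    apply: leq_trans (size_polyMleq _ _) _.
    by rewrite size_prod_XsubC /= addnC leq_add2r; exact: su.
  set q := (1 - _) * u.
  have sq : (size q <= N.+2)%N.
    apply: szX; rewrite -scaleN1r scalerA.
    apply: leq_trans (size_polyD _ _) _; rewrite size_poly1 geq_max /=.
    by apply: leq_trans (size_scale_leq _ _) _; rewrite size_polyX.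
  apply: le_trans (IH N.+1 q sq).
  rewrite /q mulrBl mul1r -(scalerAl w^* _ u) coefB coefZ coefXM /= unext sub0r normrN normrM.
  by rewrite norm_conjC exprMn mulrA [_ * `|w| ^+ 2]mulrC.
- rewrite expr1n mul1r -(mulrA _ _ u) (mulrCA _ _ u).
  have sq : (size (('X - w%:P) * u)%R <= N.+2)%N by apply: szX; rewrite size_XsubC.
  apply: le_trans (IH N.+1 _ sq).
  by rewrite mulrBl coefB coefXM coefCM /= unext mulr0 subr0.
Qed.

Lemma normC_int_ge1 (m : int) : m != 0 -> 1 <= `|(m%:~R : C)|.
Proof.
by move=> m0; rewrite -intr_norm ler1z -gtz0_ge1 normr_gt0.
Qed.

(** The cofactor of the product of the X - w in [v] has a nonzero integer as its
    leading coefficient. *)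
Lemma landau (ws : seq C) (v : {poly int}) : uniq ws -> v != 0 ->
  {in ws, forall w, root (toC v) w} ->
  mahler ws ^+ 2 <= \sum_(i < size v) (`|v`_i| ^+ 2)%:~R.
Proof.
move=> uws v0 rv.
have [u vE] : exists u, toC v = u * \prod_(z <- ws) ('X - z%:P).
  apply: uniq_roots_prod_XsubC; first by apply/allP.
  by rewrite uniq_rootsE.
have ntC : toC v != 0 by rewrite map_poly_eq0_id0 // intr_eq0 lead_coef_eq0.
have u0 : u != 0 by apply: contraNneq ntC => u0; rewrite vE u0 mul0r.
have szv : size v = ((size u).-1 + size ws).+1.
  have -> : size v = size (toC v).
    by rewrite size_map_inj_poly //; exact: intr_inj.
  rewrite vE size_Mmonic ?monic_prod_XsubC // size_prod_XsubC.
  rewrite addnS /=; move: u0; rewrite -size_poly_gt0.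
  by case: (size u) => // k _; rewrite addSn.
have szu : (size u <= (size u).-1.+1)%N by exact: leqSpred.
have := landau_aux ws szu; rewrite -szv (mulrC _ u) -vE /sqnorm.
under eq_bigr => i _ do rewrite coef_map /= -intr_norm -rmorphXn /=.
apply: le_trans; rewrite ler_peMl ?exprn_ge0 ?(le_trans ler01 (mahler_ge1 _)) //.
apply: exprn_ege1.
have -> : u`_(size u).-1 = (lead_coef v)%:~R.
  rewrite -lead_coefE -(lead_coef_map_inj (intr_inj : injective (intr : int -> C))) // vE.
  by rewrite lead_coef_Mmonic ?monic_prod_XsubC.
by rewrite normC_int_ge1 // lead_coef_eq0.
Qed.

End Landau.

(** * Vanishing at a conjugate set forces many coefficients *)

Section Rigid.
Variable C : numClosedFieldType.
Implicit Types (z w : C) (zs ws : seq C).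

Local Notation toC := (map_poly (intr : int -> C)).

(** All that is used of a full set of conjugates: no integer polynomial
    separates its elements.  In this form the property passes to the set of squares,
    whose elements may have smaller degree. *)
Definition conjugate_set zs :=
  [/\ uniq zs, 0 \notin zs, zs != [::],
      exists g : {poly int}, root (toC g) =i mem zs &
      forall (h : {poly int}) z z', z \in zs -> z' \in zs ->
        root (toC h) z -> root (toC h) z'].

(** Equivalently, a polynomial with coefficients in an interval of length [H] that
    vanishes on [zs] is determined by its coefficients of index outside [S]. *)
Definition rigid (H : nat) (S : seq nat) zs :=
  forall v : {poly int}, (forall i, `|v`_i| <= H%:Z) ->
    (forall i, i \notin S -> v`_i = 0) ->
    {in zs, forall z, root (toC v) z} -> v = 0.

Lemma rigid_iota (L H : nat) zs : uniq zs ->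
  (L * H ^ 2)%:R < mahler zs ^+ 2 -> rigid H (iota 0 L) zs.
Proof.
move=> uzs /lt_geF/negbT/negP big v vH vS rv.
apply/eqP/negPn/negP => v0; apply: big.
have szv : (size v <= L)%N.
  apply/leq_sizeP => j Lj; apply: vS.
  by rewrite mem_iota add0n /= -leqNgt.
apply: le_trans (landau uzs v0 rv) _.
have -> : (L * H ^ 2)%:R = \sum_(i < L) (H ^ 2)%:R :> C.
  by rewrite sumr_const card_ord natrM mulr_natl.
rewrite (big_ord_widen _ (fun i => (`|v`_i| ^+ 2)%:~R) szv) big_mkcond /=.
apply: ler_sum => i _; case: ifP => _; last by rewrite ler0n.
rewrite [leRHS]pmulrn ler_int -[leRHS]natz natrX natz.
by apply: lerXn2r; rewrite ?nnegrE //; exact: vH.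
Qed.

Definition squares zs := undup [seq z ^+ 2 | z <- zs].

Lemma mem_squares zs w : reflect (exists2 z, z \in zs & w = z ^+ 2) (w \in squares zs).
Proof. by rewrite mem_undup; exact: mapP. Qed.

Lemma root_toC_sqr (h : {poly int}) z :
  root (toC (h \Po 'X^2)) z = root (toC h) (z ^+ 2).
Proof. by rewrite map_comp_poly map_polyXn !rootE horner_comp hornerXn. Qed.

(** If g = a(X^2) + X b(X^2) has root set [zs], then the polynomial
    a^2 - X b^2, whose value at z^2 is g(z) g(-z), has the squares as its root set. *)
Lemma conjugate_squares zs : conjugate_set zs -> conjugate_set (squares zs).
Proof.
case=> uzs z0 ne [g gE] cj; split.
- exact: undup_uniq.
- apply/negP => /mem_squares[z zz /esym/eqP]; rewrite expf_eq0 /= => /eqP zE.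
  by rewrite -zE zz in z0.
- by case: zs ne {uzs z0 cj gE} => // z zs _; apply/eqP => /undup_nil.
- exists (even_poly g ^+ 2 - 'X * odd_poly g ^+ 2) => w.
  have rgz z : root (toC g) z = (z \in zs) by exact: gE.
  rewrite -[w in LHS]sqrtCK; set z := sqrtC w.
  have gg : (even_poly g ^+ 2 - 'X * odd_poly g ^+ 2) \Po 'X^2 = g * (g \Po - 'X).
    have -> : g \Po - 'X = even_poly g \Po 'X^2 - (odd_poly g \Po 'X^2) * 'X.
      rewrite -{1}[g]poly_even_odd comp_polyD comp_polyM -!comp_polyA.
      by rewrite comp_Xn_poly comp_polyX sqrrN mulrN.
    rewrite -{3}[g]poly_even_odd comp_polyB !expr2 !comp_polyM comp_polyX; ring.
  rewrite -topredE /= -root_toC_sqr gg.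
  rewrite rmorphM /= rootM map_comp_poly rmorphN /= map_polyX.
  have -> : root (toC g \Po - 'X) z = root (toC g) (- z).
    by rewrite !rootE horner_comp hornerN hornerX.
  rewrite !rgz; apply/idP/(mem_squares _ w) => [/orP[zz|zz]|[y yz]].
  - by exists z; rewrite ?sqrtCK.
  - by exists (- z); rewrite ?sqrrN ?sqrtCK.
  - have := sqrtCK w; rewrite -/z => zw wE; rewrite -zw in wE.
    by move/eqP: wE; rewrite eqf_sqr => /orP[]/eqP ->; rewrite ?opprK yz ?orbT.
- move=> h _ _ /mem_squares[z zz ->] /mem_squares[z' zz' ->].
  by rewrite -!root_toC_sqr; exact: cj.
Qed.

Definition doubles (S : seq nat) := [seq i.*2 | i <- S].

Lemma rigid_doubles H S zs : rigid H S (squares zs) -> rigid H (doubles S) zs.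
Proof.
move=> rS v vH vS rv.
have vE : v = even_poly v \Po 'X^2.
  rewrite -[LHS]poly_even_odd; suff -> : odd_poly v = 0 by rewrite comp_poly0 mul0r addr0.
  apply/polyP => i; rewrite coef_odd_poly coef0 vS //.
  by apply/mapP => -[j _ /(congr1 odd)]; rewrite /= !odd_double.
rewrite vE (rS (even_poly v)) ?comp_poly0 //.
- by move=> i; rewrite coef_even_poly.
- move=> i iS; rewrite coef_even_poly vS //.
  by apply: contra iS => /mapP[j jS] /double_inj ->.
- by move=> _ /mem_squares[z zz ->]; rewrite -root_toC_sqr -vE; exact: rv.
Qed.

(** g(-X) vanishes either at every element of [zs] or at none. *)
Lemma conjugate_opp zs z z' : conjugate_set zs -> z \in zs -> - z \in zs ->
  z' \in zs -> - z' \in zs.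
Proof.
case=> _ _ _ [g gE] cj zz nzz zz'.
have rgz y : root (toC g) y = (y \in zs) by exact: gE.
have rN y : root (toC (g \Po - 'X)) y = root (toC g) (- y).
  by rewrite map_comp_poly rmorphN /= map_polyX !rootE horner_comp hornerN hornerX.
by have := cj (g \Po - 'X) z z' zz zz'; rewrite !rN !rgz; apply.
Qed.

Lemma mahler1_sqr z : mahler1 (z ^+ 2) = mahler1 z ^+ 2.
Proof.
rewrite /mahler1 normrX; have [z1|z1] := boolP (1 <= `|z|).
  by rewrite exprn_ege1.
have z1' : `|z| < 1 by rewrite real_ltNge ?rpred1 ?normr_real.
have : `|z| ^+ 2 < 1 by rewrite exprn_ilt1.
by move=> /lt_geF ->; rewrite expr1n.
Qed.

Lemma squares_inj zs : conjugate_set zs -> {in zs, forall z, - z \notin zs} ->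
  squares zs = [seq z ^+ 2 | z <- zs].
Proof.
case=> uzs _ _ _ _ nzs; apply: undup_id; rewrite map_inj_in_uniq //.
move=> x y xz yz /eqP; rewrite eqf_sqr => /orP[/eqP //|/eqP xE].
by have := nzs y yz; rewrite -xE xz.
Qed.

Lemma mahler_squares zs : conjugate_set zs -> {in zs, forall z, - z \notin zs} ->
  mahler (squares zs) = mahler zs ^+ 2.
Proof.
move=> cz nzs; rewrite squares_inj // /mahler big_map -prodrXl.
by apply: eq_bigr => z _; exact: mahler1_sqr.
Qed.

(** When [zs] is symmetric, squaring is two-to-one on it. *)
Lemma perm_squares_opp zs : conjugate_set zs -> {in zs, forall z, - z \in zs} ->
  perm_eq zs ([seq sqrtC w | w <- squares zs] ++ [seq - sqrtC w | w <- squares zs]).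
Proof.
move=> [uzs z0 _ _ _] ozs; apply: uniq_perm => //.
  rewrite cat_uniq !map_inj_in_uniq ?undup_uniq //; first last.
  - by move=> x y _ _ /(congr1 (fun z => z ^+ 2)); rewrite !sqrtCK.
  - by move=> x y _ _ /(congr1 (fun z => z ^+ 2)); rewrite !sqrrN !sqrtCK.
  rewrite andbT; apply/hasPn => _ /mapP[w ws ->]; apply/mapP => -[w' _ E].
  have ww' : w = w'.
    by have := congr1 (fun z => z ^+ 2) E; rewrite /= sqrrN !sqrtCK.
  move: E; rewrite -ww' => /eqP; rewrite eqNr sqrtC_eq0 => /eqP w0.
  case/mem_squares: ws => z zz; rewrite w0 => /esym/eqP; rewrite expf_eq0 /= => /eqP z00.
  by rewrite -z00 zz in z0.
move=> z; rewrite mem_cat; apply/idP/orP => [zz|].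
  have := sqrtCK (z ^+ 2) => /eqP; rewrite eqf_sqr => /orP[]/eqP E.
    by left; apply/mapP; exists (z ^+ 2) => //; apply/mem_squares; exists z.
  right; apply/mapP; exists (z ^+ 2); first by apply/mem_squares; exists z.
  by rewrite E opprK.
by case=> /mapP[_ /mem_squares[y yz ->] ->];
  have := sqrtCK (y ^+ 2) => /eqP; rewrite eqf_sqr => /orP[]/eqP ->;
  rewrite ?opprK ?ozs.
Qed.

Lemma mahler_squares_opp zs : conjugate_set zs -> {in zs, forall z, - z \in zs} ->
  mahler (squares zs) = mahler zs.
Proof.
move=> cz ozs; rewrite /mahler (perm_big _ (perm_squares_opp cz ozs)) /=.
rewrite big_cat /= !big_map -big_split /=; apply: eq_bigr => w _.
have -> : mahler1 (- sqrtC w) = mahler1 (sqrtC w) by rewrite /mahler1 normrN.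
by rewrite -expr2 -mahler1_sqr sqrtCK.
Qed.

Lemma size_squares_opp zs : conjugate_set zs -> {in zs, forall z, - z \in zs} ->
  size zs = (size (squares zs)).*2.
Proof.
by move=> cz ozs; rewrite (perm_size (perm_squares_opp cz ozs)) size_cat !size_map addnn.
Qed.

Definition pairs (S : seq nat) := doubles S ++ [seq i.*2.+1 | i <- S].

(** The values of v at z and -z determine those at z^2 of the even and odd parts
    of v, so both parts vanish on the squares. *)
Lemma rigid_pairs H S zs : 0 \notin zs -> {in zs, forall z, - z \in zs} ->
  rigid H S (squares zs) -> rigid H (pairs S) zs.
Proof.
move=> z0 ozs rS v vH vS rv.
have vE z : (toC v).[z] = (toC (even_poly v)).[z ^+ 2] + z * (toC (odd_poly v)).[z ^+ 2].
  rewrite -{1}[v]poly_even_odd rmorphD rmorphM /= map_polyX.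
  by rewrite hornerD hornerMX !map_comp_poly map_polyXn !horner_comp hornerXn mulrC.
have eo z : z \in zs -> (toC (even_poly v)).[z ^+ 2] = 0 /\ (toC (odd_poly v)).[z ^+ 2] = 0.
  move=> zz; have zn0 : z != 0 by apply: contraNneq z0 => <-.
  have := rv z zz; have := rv (- z) (ozs z zz).
  rewrite !rootE !vE sqrrN mulNr; set A := _.[_]; set B := _.[_].
  move=> /eqP E1 /eqP E2.
  have A0 : A = 0.
    have : A *+ 2 = 0 by rewrite mulr2n -[RHS]addr0 -{1}E1 -E2; ring.
    by move=> /eqP; rewrite mulrn_eq0 /= => /eqP.
  split=> //; move: E2; rewrite A0 add0r => /eqP; rewrite mulf_eq0 (negbTE zn0).
  by move=> /eqP.
have e0 : even_poly v = 0.
  apply: rS => [i|i iS|_ /mem_squares[z zz ->]].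
  - by rewrite coef_even_poly.
  - rewrite coef_even_poly vS // mem_cat negb_or; apply/andP.
    split; apply/mapP => -[j jS].
      by move=> /double_inj E; rewrite E jS in iS.
    by move=> /(congr1 odd); rewrite /= !odd_double.
  - by apply/eqP; exact: (eo z zz).1.
have o0 : odd_poly v = 0.
  apply: rS => [i|i iS|_ /mem_squares[z zz ->]].
  - by rewrite coef_odd_poly.
  - rewrite coef_odd_poly vS // mem_cat negb_or; apply/andP.
    split; apply/mapP => -[j jS].
      by move=> /(congr1 odd); rewrite /= !odd_double.
    by move=> [] /double_inj E; rewrite E jS in iS.
  - by apply/eqP; exact: (eo z zz).2.
by rewrite -[v]poly_even_odd e0 o0 comp_poly0 mul0r addr0.
Qed.

Lemma uniq_doubles S : uniq S -> uniq (doubles S).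
Proof. by rewrite map_inj_uniq //; exact: double_inj. Qed.

Lemma uniq_pairs S : uniq S -> uniq (pairs S).
Proof.
move=> uS; rewrite cat_uniq uniq_doubles //= map_inj_uniq ?uS ?andbT; last first.
  by move=> i j [] /double_inj.
apply/hasPn => _ /mapP[i _ ->]; apply/mapP => -[j _ /(congr1 odd)].
by rewrite /= !odd_double.
Qed.

(** Square the conjugates [s] times.  A squaring that is injective doubles the
    exponent of the Mahler measure and restricts the indices to even ones, halving
    their number; this is needed [u] times before Landau's inequality applies.  The
    other squarings halve the degree, keep the Mahler measure and lose no index; their
    number is at most log2 of the degree. *)
Lemma rigid_exists (s u L' H : nat) zs : conjugate_set zs ->
  (size zs * 2 ^ u <= 2 ^ s)%N ->
  ((2 ^ s * L') * H ^ 2)%:R < mahler zs ^+ (2 * 2 ^ u) ->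
  exists S, [/\ uniq S, all (fun i => i < 2 ^ s * L')%N S,
                size S = (2 ^ (s - u) * L')%N & rigid H S zs].
Proof.
elim: s u zs => [|s IH] [|u] zs cz szle big; have [uz z0 ne _ _] := cz.
- exists (iota 0 (2 ^ 0 * L')); rewrite iota_uniq size_iota subn0; split=> //.
    by apply/allP => i; rewrite mem_iota.
  by apply: rigid_iota => //; move: big; rewrite expn0 muln1.
- have : (0 < size zs)%N by rewrite lt0n size_eq0.
  move: szle; rewrite expn0 expnS; have := expn_gt0 2 u; nia.
- exists (iota 0 (2 ^ s.+1 * L')); rewrite iota_uniq size_iota subn0; split=> //.
    by apply/allP => i; rewrite mem_iota.
  by apply: rigid_iota => //; move: big; rewrite expn0 muln1.
have cz2 := conjugate_squares cz.
have L'le : ((2 ^ s * L') * H ^ 2)%:R <= ((2 ^ s.+1 * L') * H ^ 2)%:R :> C.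
  by rewrite ler_nat leq_mul // leq_mul // leq_exp2l.
have [/hasP[z zz /= nzz]|/hasPn nzs] := boolP (has (fun z => - z \in zs) zs).
- have ozs z' : z' \in zs -> - z' \in zs by move=> zz'; apply: conjugate_opp nzz zz'.
  have sz := size_squares_opp cz ozs.
  have sz2 : (0 < size (squares zs))%N by case: cz2 => _ _ ne2 _ _; rewrite lt0n size_eq0.
  have szle2 : (size (squares zs) * 2 ^ u.+1 <= 2 ^ s)%N.
    by rewrite -leq_double doubleMl -sz -mul2n -expnS.
  have us : (u.+1 <= s)%N.
    rewrite -(leq_exp2l u.+1 s (isT : 1 < 2)%N); apply: leq_trans szle2.
    by rewrite leq_pmull.
  have [|S [uS aS sS rS]] := IH u.+1 (squares zs) cz2 szle2.
    by rewrite mahler_squares_opp //; apply: le_lt_trans big.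
  exists (pairs S); split.
  - exact: uniq_pairs.
  - apply/allP => i; rewrite mem_cat expnS -mulnA.
    by case/orP => /mapP[j /(allP aS) jS ->]; lia.
  - by rewrite size_cat !size_map sS addnn subSn // expnS -mul2n mulnA.
  - exact: rigid_pairs.
- have sz : size (squares zs) = size zs by rewrite squares_inj // size_map.
  have [| |S [uS aS sS rS]] := IH u (squares zs) cz2.
  - by rewrite sz -leq_double doubleMr -!mul2n -!expnS.
  - rewrite mahler_squares // -exprM; apply: le_lt_trans L'le _.
    by rewrite -(expnS 2 u).
  exists (doubles S); split.
  - exact: uniq_doubles.
  - apply/allP => i /mapP[j /(allP aS) jS ->]; rewrite expnS -mulnA; lia.
  - by rewrite size_map sS subSS.
  - exact: rigid_doubles.
Qed.

End Rigid.

(** * Hadamard's inequality, multiplication matrices, Frobenius *)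

Section Hadamard.
Variable C : numClosedFieldType.
Local Notation "A ^*t" := (map_mx Num.conj A^T) (at level 8).

(** Gram-Schmidt: A = T U with U unitary and T triangular with the same row norms
    as A, each of which bounds the diagonal entry of T in its row. *)
Lemma hadamard n (A : 'M[C]_n) :
  `|\det A| ^+ 2 <= \prod_i \sum_j `|A i j| ^+ 2.
Proof.
pose U := schmidt A.
have uU : U \is unitarymx by exact: schmidt_unitarymx.
have UU : U *m U ^*t = 1%:M by apply/unitarymxP.
have UU' : U ^*t *m U = 1%:M by apply: mulmx1C.
pose T := A *m U ^*t.
have AE : A = T *m U by rewrite /T -mulmxA UU' mulmx1.
have Ttrig : is_trig_mx T.
  apply/is_trig_mxP => i j ij.
  have /sub_sumsmxP[u uE] := row_schmidt_sub A i.
  have : row i A *m (row j U) ^*t = 0.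
    rewrite uE mulmx_suml big1 // => k ki.
    have /submxP[w ->] : (u k *m <<row k (schmidt A)>> <= row k U)%MS.
      by rewrite (submx_trans (submxMl _ _)) // genmxE.
    rewrite -mulmxA; suff -> : row k U *m (row j U) ^*t = 0 by rewrite mulmx0.
    have := congr1 (fun M : 'M[C]_n => M k j) UU; rewrite !mxE.
    have kj : (k == j) = false by apply/negbTE; rewrite -val_eqE neq_ltn (leq_ltn_trans ki ij).
    rewrite kj mulr0n => E; apply/matrixP => a b; rewrite !ord1 !mxE -[RHS]E.
    by apply: eq_bigr => x _; rewrite !mxE.
  move/matrixP/(_ 0 0); rewrite !mxE => E; rewrite -[RHS]E.
  by apply: eq_bigr => x _; rewrite !mxE.
have detU : `|\det U| = 1.
  have := congr1 determinant UU; rewrite det_mulmx det_map_mx det_tr det1.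
  move=> E; apply/eqP; rewrite -(@eqrXn2 _ 2) ?ler01 ?normr_ge0 //.
  by rewrite expr1n normCK E.
have rowT i : \sum_j `|T i j| ^+ 2 = \sum_j `|A i j| ^+ 2.
  have : T *m T ^*t = A *m A ^*t.
    (* A and T have the same Gram matrix of rows, as U is unitary. *)
    have tAE : A ^*t = U ^*t *m T ^*t by rewrite {1}AE (trmx_mul T U) map_mxM.
    by rewrite tAE [X in _ = X *m _]AE -(mulmxA T U) (mulmxA U) UU mul1mx.
  move/matrixP/(_ i i); rewrite !mxE => E.
  rewrite (eq_bigr (fun j => T i j * (T ^*t) j i)); last by move=> j _; rewrite !mxE normCK.
  rewrite E; by apply: eq_bigr => j _; rewrite !mxE normCK.
rewrite AE det_mulmx normrM detU mulr1 det_trig // normr_prod -prodrXl.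
apply: ler_prod => i _; rewrite exprn_ge0 //= -AE -rowT (bigD1 i) //= lerDl.
by rewrite sumr_ge0 // => j _; rewrite exprn_ge0.
Qed.
End Hadamard.

Definition seq_row (R : nmodType) (xs : seq R) : 'rV[R]_(size xs) := \row_j xs`_j.

Section MulMod.
Variable C : numFieldType.
Local Notation toC := (map_poly (intr : int -> C)).
Variables (g : {poly int}) (zs : seq C).
Hypotheses (gm : g \is monic) (uz : uniq zs) (gE : toC g = \prod_(z <- zs) ('X - z%:P)).
Local Notation n := (size zs).

Lemma size_mulmod : size g = n.+1.
Proof.
rewrite -(size_prod_XsubC zs id) -gE size_map_inj_poly //; exact: intr_inj.
Qed.

Lemma root_mulmod z : z \in zs -> root (toC g) z.
Proof. by rewrite gE root_prod_XsubC. Qed.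

Lemma rmodp_eval (h : {poly int}) z : z \in zs ->
  (toC (Pdiv.Ring.rmodp h g)).[z] = (toC h).[z].
Proof.
move=> /root_mulmod /rootP gz.
rewrite {2}(Pdiv.RingMonic.rdivp_eq gm h) rmorphD rmorphM /= hornerD hornerM gz.
by rewrite mulr0 add0r.
Qed.

(** Multiplication by [h] modulo [g] in the basis of the powers of X. *)
Definition mulmod_mx (h : {poly int}) : 'M[int]_n :=
  \matrix_(i < n, j < n) (Pdiv.Ring.rmodp ('X^i * h) g)`_j.

Lemma det_root_Vandermonde : \det (Vandermonde n (seq_row zs)) != 0.
Proof.
rewrite det_Vandermonde; apply/prodf_neq0 => i _; apply/prodf_neq0 => j ij.
by rewrite !mxE subr_eq0 nth_uniq // gtn_eqF.
Qed.

(** Evaluation at the roots of [g], that is the Vandermonde matrix, diagonalises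
    multiplication by [h].  Hence the trace and the characteristic polynomial of the
    integer matrix [mulmod_mx h] are symmetric functions of the values h(z). *)
Lemma mulmod_diag h :
  map_mx intr (mulmod_mx h) *m Vandermonde n (seq_row zs)
   = Vandermonde n (seq_row zs) *m diag_mx (\row_j (toC h).[zs`_j]).
Proof.
apply/matrixP => i j; rewrite mul_mx_diag !mxE.
have zj : zs`_j \in zs by rewrite mem_nth.
have := rmodp_eval ('X^i * h) zj.
rewrite rmorphM /= map_polyXn hornerM hornerXn => <-.
rewrite (@horner_coef_wide _ n); last first.
  rewrite size_map_inj_poly //; last exact: intr_inj.
  by rewrite -ltnS -size_mulmod; apply: Pdiv.Ring.ltn_rmodpN0; exact: monic_neq0.
by apply: eq_bigr => k _; rewrite !mxE coef_map.
Qed.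

Lemma sum_conj_int h : \sum_(z <- zs) (toC h).[z] = (\tr (mulmod_mx h))%:~R.
Proof.
have Vu : Vandermonde n (seq_row zs) \in unitmx by rewrite unitmxE unitfE det_root_Vandermonde.
have E : map_mx intr (mulmod_mx h) =
   Vandermonde n (seq_row zs) *m diag_mx (\row_j (toC h).[zs`_j]) *m invmx (Vandermonde n (seq_row zs)).
  by rewrite -mulmod_diag mulmxK.
rewrite -trace_map_mx E mxtrace_mulC mulmxA mulVmx // mul1mx mxtrace_diag.
by rewrite (big_nth 0) big_mkord; apply: eq_bigr => i _; rewrite mxE.
Qed.

Lemma charpoly_conj_int h :
  \prod_(z <- zs) ('X - ((toC h).[z])%:P) = toC (char_poly (mulmod_mx h)).
Proof.
rewrite map_char_poly.
pose V := map_mx polyC (Vandermonde n (seq_row zs)).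
have dV : \det V != 0 by rewrite det_map_mx polyC_eq0 det_root_Vandermonde.
apply: (mulIf dV); rewrite /char_poly -det_mulmx.
have -> : char_poly_mx (map_mx intr (mulmod_mx h)) *m V
   = V *m diag_mx (\row_j ('X - ((toC h).[zs`_j])%:P)).
  rewrite /char_poly_mx mulmxBl -map_mxM mulmod_diag map_mxM -scalar_mxC -mulmxBr.
  congr (_ *m _); apply/matrixP => i j; rewrite !mxE.
  by case: eqP => _; rewrite ?mulr1n ?mulr0n ?rmorph0 ?subrr.
rewrite det_mulmx det_diag mulrC; congr (_ * _).
by rewrite (big_nth 0) big_mkord; apply: eq_bigr => i _; rewrite mxE.
Qed.

End MulMod.

(** The Frobenius endomorphism of F_p[X] is the substitution of X^p for X. *)
Lemma comp_Xp_int (g : {poly int}) p : prime p ->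
  exists q : {poly int}, g \Po 'X^p = g ^+ p + p%:R * q.
Proof.
move=> pp.
have pc : p \in [pchar 'F_p] by rewrite inE /= pp /= pchar_Fp_0.
have pc2 : p \in [pchar {poly 'F_p}] by rewrite pchar_poly.
pose toF := map_poly (intr : int -> 'F_p).
have frob (h : {poly 'F_p}) : h \Po 'X^p = h ^+ p.
  rewrite -[RHS](pFrobenius_autE pc2) -{2}[h]coefK poly_def rmorph_sum /=.
  rewrite -{1}[h]coefK poly_def linear_sum /=; apply: eq_bigr => i _.
  rewrite linearZ /= -!mul_polyC rmorphM /= !pFrobenius_autE -polyC_exp.
  rewrite comp_Xn_poly -!exprM mulnC; congr (_%:P * _).
  by have := expf_card (h`_i : 'F_p); rewrite card_Fp // => ->.
have E : toF (g \Po 'X^p - g ^+ p) = 0.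
  by rewrite /toF rmorphB /= map_comp_poly map_polyXn rmorphXn /= frob subrr.
set D := g \Po 'X^p - g ^+ p in E.
exists (\poly_(i < size D) (D`_i %/ p)%Z).
apply/eqP; rewrite addrC -subr_eq -/D; apply/eqP/polyP => i.
rewrite mulr_natl coefMn coef_poly; case: ltnP => [_|si]; last first.
  by rewrite nth_default // mul0rn.
rewrite -mulr_natr natz divzK //.
rewrite (dvdz_pcharf pc).
by have /polyP/(_ i) := E; rewrite coef_map coef0 => /= ->.
Qed.

(** * The Vandermonde determinant of conjugates and their p-th powers *)

Section Measure.
Variable C : numClosedFieldType.
Implicit Types (z w : C) (zs ws xs : seq C).
Local Notation toC := (map_poly (intr : int -> C)).

(** Up to sign, the square of the Vandermonde determinant. *)
Definition diffs xs : C := \prod_(x <- xs) \prod_(y <- xs | y != x) (x - y).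

Lemma prod_offdiag (R : comRingType) n (F : 'I_n -> 'I_n -> R) :
  (forall i j, F i j = F j i) ->
  \prod_i \prod_(j | j != i) F i j = (\prod_(i < n) \prod_(j < n | (i < j)%N) F i j) ^+ 2.
Proof.
move=> Fsym.
under eq_bigr => i _ do rewrite (bigID (fun j : 'I_n => (i < j)%N)) /=.
rewrite big_split /= expr2; congr (_ * _).
  apply: eq_bigr => i _; apply: eq_bigl => j; case: ltngtP => ij; rewrite ?andbF ?andbT //.
  by rewrite -val_eqE /= gtn_eqF.
rewrite (exchange_big_dep xpredT) //=; apply: eq_bigr => j _.
rewrite (eq_bigr (fun i => F j i)) //; apply: eq_bigl => i.
by rewrite -leqNgt ltn_neqAle -val_eqE.
Qed.

Lemma norm_det_Vandermonde xs : uniq xs ->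
  `|\det (Vandermonde (size xs) (seq_row xs))| ^+ 2 = `|diffs xs|.
Proof.
move=> ux; rewrite det_Vandermonde /diffs !normr_prod.
rewrite (eq_bigr (fun i : 'I_(size xs) =>
   \prod_(j < size xs | (i < j)%N) `|xs`_j - xs`_i|)); last first.
  by move=> i _; rewrite normr_prod; apply: eq_bigr => j _; rewrite !mxE.
rewrite -prod_offdiag; last by move=> i j; rewrite distrC.
rewrite [RHS](big_nth 0) big_mkord; apply: eq_bigr => i _.
rewrite normr_prod [RHS](big_nth 0) big_mkord; apply: eq_big => j; last by rewrite distrC.
by rewrite nth_uniq.
Qed.

Lemma det_Vandermonde_le xs :
  `|\det (Vandermonde (size xs) (seq_row xs))| ^+ 2
    <= (size xs)%:R ^+ size xs * mahler xs ^+ (2 * (size xs).-1).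
Proof.
rewrite -det_tr; apply: le_trans (hadamard _) _.
have -> : (size xs)%:R ^+ size xs * mahler xs ^+ (2 * (size xs).-1)
    = \prod_(i < size xs) ((size xs)%:R * mahler1 xs`_i ^+ (2 * (size xs).-1)).
  rewrite big_split /= prodr_const card_ord; congr (_ * _).
  by rewrite prodrXl /mahler (big_nth 0) big_mkord.
apply: ler_prod => i _; apply/andP; split.
  by rewrite sumr_ge0 // => j _; rewrite exprn_ge0.
set c := mahler1 _ ^+ _.
have -> : (size xs)%:R * c = \sum_(j < size xs) c.
  by rewrite sumr_const card_ord mulr_natl.
apply: ler_sum => j _; rewrite !mxE normrX -exprM /c.
apply: (@le_trans _ _ (mahler1 xs`_i ^+ (j * 2))).
  by rewrite lerXn2r ?nnegrE ?(le_trans ler01 (mahler1_ge1 _)) ?norm_le_mahler1.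
rewrite ler_weXn2l ?mahler1_ge1 // mulnC leq_mul2l /=.
by rewrite -ltnS prednK // (leq_ltn_trans (leq0n j)).
Qed.

Lemma deriv_root_prod (f : C -> C) xs x : uniq xs -> x \in xs ->
  (\prod_(y <- xs) ('X - (f y)%:P))^`().[f x] = \prod_(y <- xs | y != x) (f x - f y).
Proof.
move=> ux xx; rewrite (bigD1_seq x) //= derivM derivXsubC mul1r hornerD hornerM.
rewrite hornerXsubC subrr mul0r addr0 horner_prod.
by apply: eq_bigr => y _; rewrite hornerXsubC.
Qed.

Section Conj.
Variables (g : {poly int}) (zs : seq C).
Hypotheses (gm : g \is monic) (uz : uniq zs) (gE : toC g = \prod_(z <- zs) ('X - z%:P)).
Local Notation n := (size zs).

Lemma prod_conj_int (h : {poly int}) : exists m : int, \prod_(z <- zs) (toC h).[z] = m%:~R.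
Proof.
have := charpoly_conj_int gm uz gE (- h) => /(congr1 (horner^~ 0)).
rewrite horner_prod horner_coef0 coef_map /= => E.
exists (char_poly (mulmod_mx g zs (- h)))`_0; rewrite -E; apply: eq_bigr => z _.
by rewrite hornerXsubC rmorphN hornerN sub0r opprK.
Qed.

Lemma norm_prod_conj_ge1 (h : {poly int}) :
  {in zs, forall z, (toC h).[z] != 0} -> 1 <= `|\prod_(z <- zs) (toC h).[z]|.
Proof.
move=> h0; have [m mE] := prod_conj_int h.
rewrite mE normC_int_ge1 // -(intr_eq0 C) -mE.
by rewrite prodf_seq_neq0; apply/allP => z zz; apply/implyP => _; exact: h0.
Qed.

Lemma deriv_conj z : z \in zs -> (toC g^`()).[z] = \prod_(y <- zs | y != z) (z - y).
Proof. by move=> zz; rewrite -deriv_map gE (deriv_root_prod id). Qed.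

Lemma toC_Xp p (h : {poly int}) z : (toC (h \Po 'X^p)).[z] = (toC h).[z ^+ p].
Proof. by rewrite map_comp_poly map_polyXn horner_comp hornerXn. Qed.

Variable p : nat.
Hypotheses (pp : prime p) (uzp : uniq [seq z ^+ p | z <- zs])
  (zpz : {in zs, forall z, z ^+ p \notin zs}).

Let xs := zs ++ [seq z ^+ p | z <- zs].

Lemma uniq_zs_zp : uniq xs.
Proof.
rewrite cat_uniq uz uzp andbT /=; apply/hasPn => _ /mapP[z zz ->]; exact: zpz.
Qed.

(** By [comp_Xp_int] each factor g(z^p) is p q(z) for an integer polynomial q, and
    the product of the q(z) is a nonzero integer. *)
Lemma resultant_ge : (p ^ n)%:R <= `|\prod_(z <- zs) (toC g).[z ^+ p]|.
Proof.
have [q qE] := comp_Xp_int g pp.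
have gq z : z \in zs -> (toC g).[z ^+ p] = p%:R * (toC q).[z].
  move=> zz; rewrite -toC_Xp qE rmorphD rmorphM rmorphXn /= rmorph_nat.
  have gz : (toC g).[z] = 0 by apply/rootP; rewrite gE root_prod_XsubC.
  rewrite hornerD horner_exp gz expr0n gtn_eqF ?prime_gt0 // add0r.
  by rewrite !mulr_natl hornerMn.
rewrite (eq_big_seq (fun z => p%:R * (toC q).[z])) // big_split /=.
rewrite big_const_seq count_predT iter_mulr_1 normrM normrX normr_nat natrX.
rewrite ler_peMr ?exprn_ge0 ?ler0n // norm_prod_conj_ge1 // => z zz.
apply/eqP => q0; have := gq z zz; rewrite q0 mulr0 => /eqP.
by rewrite -[_ == 0]/(root _ _) gE root_prod_XsubC (negbTE (zpz zz)).
Qed.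

(** The product splits into the discriminants of [zs] and of the p-th powers, which
    are nonzero integers, and the square of the resultant. *)
Lemma diffs_ge : (p ^ (2 * n))%:R <= `|diffs xs|.
Proof.
have gx x : \prod_(y <- zs) (x - y) = (toC g).[x].
  by rewrite gE horner_prod; apply: eq_bigr => y _; rewrite hornerXsubC.
have xsE : diffs xs = (\prod_(z <- zs) (toC g^`()).[z])
    * (\prod_(z <- zs) \prod_(y <- zs) (z - y ^+ p))
    * (\prod_(z <- zs) (toC g).[z ^+ p])
    * (\prod_(z <- zs) \prod_(y <- [seq y ^+ p | y <- zs] | y != z ^+ p) (z ^+ p - y)).
  rewrite /diffs big_cat /= big_map -[X in _ = X * _ * _]big_split -[RHS]mulrA.
  rewrite -[X in _ = _ * X]big_split /=.
  congr (_ * _); apply: eq_big_seq => z zz; rewrite big_cat /=.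
    rewrite deriv_conj //; congr (_ * _).
    rewrite big_map [LHS]big_seq_cond [RHS]big_seq; apply: eq_bigl => y.
    by case yy: (y \in zs) => //=; case: eqP => // yz; have := zpz yy; rewrite yz zz.
  congr (_ * _); rewrite -gx [LHS]big_seq_cond [RHS]big_seq; apply: eq_bigl => y.
  by case yy: (y \in zs) => //=; case: eqP => // yz; have := zpz zz; rewrite -yz yy.
have Rn : `|\prod_(z <- zs) \prod_(y <- zs) (z - y ^+ p)| = `|\prod_(z <- zs) (toC g).[z ^+ p]|.
  rewrite exchange_big /= !normr_prod; apply: eq_bigr => z _.
  by rewrite -gx !normr_prod; apply: eq_bigr => y _; rewrite distrC.
rewrite xsE !normrM Rn mulnC expnM natrX expr2.
have [G GE] : exists G : {poly int}, toC G = \prod_(y <- [seq z ^+ p | z <- zs]) ('X - y%:P).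
  exists (char_poly (mulmod_mx g zs 'X^p)); rewrite -charpoly_conj_int // big_map.
  by apply: eq_bigr => z _; rewrite map_polyXn hornerXn.
have GE' z : z \in zs -> (toC (G^`() \Po 'X^p)).[z] =
    \prod_(y <- [seq y ^+ p | y <- zs] | y != z ^+ p) (z ^+ p - y).
  by move=> zz; rewrite toC_Xp -deriv_map GE (deriv_root_prod id) //; exact: (map_f (fun z => z ^+ p) zz).
rewrite -(eq_big_seq _ GE').
have D1 : 1 <= `|\prod_(z <- zs) (toC g^`()).[z]|.
  apply: norm_prod_conj_ge1 => z zz; rewrite deriv_conj //.
  by rewrite prodf_seq_neq0; apply/allP => y _; apply/implyP; rewrite subr_eq0 eq_sym.
have D2 : 1 <= `|\prod_(z <- zs) (toC (G^`() \Po 'X^p)).[z]|.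
  apply: norm_prod_conj_ge1 => z zz; rewrite GE' //.
  by rewrite prodf_seq_neq0; apply/allP => y _; apply/implyP; rewrite subr_eq0 eq_sym.
have R0 := resultant_ge; set R := `|\prod_(z <- zs) (toC g).[z ^+ p]| in R0 *.
have pn0 : 0 <= (p ^ n)%:R :> C by rewrite ler0n.
have RR : (p ^ n)%:R * (p ^ n)%:R <= R * R by rewrite ler_pM.
have RR0 : 0 <= R * R by rewrite mulr_ge0 ?normr_ge0.
apply: le_trans RR _; rewrite -[_ * R * R]mulrA.
have RD : R * R <= `|\prod_(z <- zs) (toC g^`()).[z]| * (R * R) by rewrite ler_peMl.
by apply: le_trans (RD) _; rewrite ler_peMr // (le_trans RR0 RD).
Qed.

Lemma vandermonde_bound :
  (p ^ (2 * n))%:R <= (2 * n)%:R ^+ (2 * n) * mahler zs ^+ (p.+1 * (4 * n)).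
Proof.
apply: le_trans diffs_ge _; rewrite -norm_det_Vandermonde ?uniq_zs_zp //.
apply: le_trans (det_Vandermonde_le _) _.
rewrite size_cat size_map addnn -mul2n.
have mp z : mahler1 (z ^+ p) <= mahler1 z ^+ p.
  rewrite {1}/mahler1; case: ifP => _; last by rewrite exprn_ege1 ?mahler1_ge1.
  by rewrite normrX lerXn2r ?nnegrE ?(le_trans ler01 (mahler1_ge1 _)) ?norm_le_mahler1.
have mx : mahler xs <= mahler zs ^+ p.+1.
  rewrite /mahler big_cat /= big_map exprS; apply: ler_pM => //.
  - exact: le_trans ler01 (mahler_ge1 _).
  - by rewrite prodr_ge0 // => z _; exact: le_trans ler01 (mahler1_ge1 _).
  rewrite -prodrXl; apply: ler_prod => z _; rewrite mp andbT.
  exact: le_trans ler01 (mahler1_ge1 _).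
have m0 := le_trans ler01 (mahler_ge1 zs); have x0 := le_trans ler01 (mahler_ge1 xs).
rewrite ler_wpM2l ?exprn_ge0 ?ler0n // (exprM (mahler zs)).
have mx4 : mahler xs ^+ (4 * n) <= (mahler zs ^+ p.+1) ^+ (4 * n).
  by rewrite lerXn2r ?nnegrE ?exprn_ge0.
apply: le_trans mx4; rewrite ler_weXn2l ?mahler_ge1 //; lia.
Qed.

(** Compare the lower bound p^(2n) for the squared Vandermonde determinant with
    Hadamard's bound; p >= 4n wins over the factor (2n)^(2n). *)
Lemma mahler_ge_of_prime : zs != [::] -> (4 * n <= p)%N -> 2 <= mahler zs ^+ (2 * p.+1).
Proof.
move=> zs0 np; have n0 : (0 < n)%N by rewrite lt0n size_eq0.
have m0 := le_trans ler01 (mahler_ge1 zs).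
have := vandermonde_bound.
rewrite (_ : p.+1 * (4 * n) = 2 * p.+1 * (2 * n))%N; last by lia.
set M := mahler zs ^+ (2 * p.+1); have M0 : 0 <= M by rewrite exprn_ge0.
rewrite (exprM (mahler zs)) -/M -exprMn natrX ler_pXn2r ?nnegrE ?mulr_ge0 ?ler0n ?muln_gt0 //.
move=> pM; have n0' : 0 < (2 * n)%:R :> C by rewrite ltr0n muln_gt0.
rewrite -(ler_pM2l n0'); apply: le_trans pM.
by rewrite -natrM ler_nat; lia.
Qed.

End Conj.
End Measure.

(** * Lower bound for the Mahler measure; power sums *)

Section Galois.
Variable C : numClosedFieldType.
Implicit Types (z w : C) (zs ws xs : seq C).
Local Notation toC := (map_poly (intr : int -> C)).

(** A full set of conjugate algebraic integers. *)
Definition galois_set zs :=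
  conjugate_set zs /\
  exists g : {poly int}, g \is monic /\ toC g = \prod_(z <- zs) ('X - z%:P).

(** Iterating the p-th power inside a finite set, two iterates coincide. *)
Lemma pow_in_unity p z zs : (1 < p)%N -> z \in zs -> z != 0 ->
  {in zs, forall y, y ^+ p \in zs} -> exists2 k, (0 < k)%N & z ^+ k = 1.
Proof.
move=> p1 zz z0 cl.
have zi i : z ^+ (p ^ i) \in zs.
  by elim: i => [|i IH]; rewrite ?expn0 ?expr1 // expnSr exprM cl.
have [//|] := boolP (uniq [seq z ^+ (p ^ i) | i <- iota 0 (size zs).+1]).
  move=> u; have : (size [seq z ^+ (p ^ i) | i <- iota 0 (size zs).+1] <= size zs)%N.
    by apply: uniq_leq_size => // _ /mapP[i _ ->].
  by rewrite size_map size_iota ltnn.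
move/(uniqPn 0) => [i [j [ij]]]; rewrite size_map size_iota => jn.
rewrite !(nth_map 0%N) ?size_iota ?(ltn_trans ij jn) // !nth_iota ?(ltn_trans ij jn) // !add0n.
have pij : (p ^ i < p ^ j)%N by rewrite ltn_exp2l.
move=> E; exists (p ^ j - p ^ i)%N; first by rewrite subn_gt0.
have zp0 : z ^+ (p ^ i) != 0 by rewrite expf_neq0.
apply: (mulfI zp0); rewrite -exprD mulr1 subnKC //; exact: ltnW.
Qed.

(** A prime p can be used if no z^p is in [zs] and the z^p are distinct.  The first
    condition holds because the z are not roots of unity.  If the second fails for p,
    then by conjugation a fixed element w of [zs] has a conjugate v, other than w, with
    v^p = w^p; distinct primes give distinct v, so there are fewer bad primes than
    elements of [zs]. *)
Lemma mahler_ge_of_primes zs (ps : seq nat) (X : nat) : galois_set zs ->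
  {in zs, forall z k, (0 < k)%N -> z ^+ k <> 1} ->
  uniq ps -> (size zs <= size ps)%N ->
  {in ps, forall p, prime p /\ (4 * size zs <= p <= X)%N} ->
  2 <= mahler zs ^+ (4 * X).
Proof.
move=> [[uz z0 ne _ cj] [g [gm gE]]] nu ups szp psP.
have zn0 z : z \in zs -> z != 0 by move=> zz; apply: contraNneq z0 => <-.
have [/hasP[p pps up]|/hasPn nup] := boolP (has (fun p => uniq [seq z ^+ p | z <- zs]) ps).
- have [pp /andP[np pX]] := psP p pps.
  apply: (@le_trans _ _ (mahler zs ^+ (2 * p.+1))); last first.
    by rewrite ler_weXn2l ?mahler_ge1 //; have := prime_gt1 pp; lia.
  apply: (mahler_ge_of_prime gm uz gE pp up _ ne np) => z zz; apply/negP => zpz.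
  have [k k0 zk] : exists2 k, (0 < k)%N & z ^+ k = 1.
    apply: (pow_in_unity (prime_gt1 pp) zz (zn0 z zz)) => y yy.
    have rg w : root (toC (g \Po 'X^p)) w = (w ^+ p \in zs).
      by rewrite rootE toC_Xp gE -[_ == 0]/(root _ _) root_prod_XsubC.
    by rewrite -rg; apply: cj zz yy _; rewrite rg.
  exact: nu zz k k0 zk.
exfalso.
have [w ww] : exists w, w \in zs by case: zs ne {uz z0 cj gE nu szp psP zn0 nup} => // w s _; exists w; rewrite mem_head.
have bad p : p \in ps -> exists2 y, y \in zs & (y != w) && (w ^+ p == y ^+ p).
  move=> pps; have := nup p pps; have p0 := prime_gt0 (psP p pps).1.
  move=> nu'.
  have [x [y [xx yy xy xyp]]] : exists x y, [/\ x \in zs, y \in zs, x != y & x ^+ p = y ^+ p].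
    move/(uniqPn 0): nu' => [i [j [ij]]]; rewrite size_map => jn.
    rewrite !(nth_map 0) ?(ltn_trans ij jn) // => E.
    exists zs`_i, zs`_j; rewrite !mem_nth ?(ltn_trans ij jn) //; split=> //.
    by rewrite nth_uniq ?(ltn_trans ij jn) // ltn_eqF.
  pose G := char_poly (mulmod_mx g zs 'X^p).
  have GE : toC G = \prod_(y <- zs) ('X - (y ^+ p)%:P).
    rewrite /G -(charpoly_conj_int gm uz gE).
    by apply: eq_bigr => z _; rewrite map_polyXn hornerXn.
  have dG z : z \in zs -> (toC (G^`() \Po 'X^p)).[z] = \prod_(y <- zs | y != z) (z ^+ p - y ^+ p).
    move=> zz; rewrite toC_Xp -deriv_map GE.
    exact: (deriv_root_prod (fun z => z ^+ p) uz zz).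
  have : root (toC (G^`() \Po 'X^p)) w.
    apply: (cj _ _ _ xx ww); rewrite rootE dG //. rewrite prodf_seq_eq0; apply/hasP.
    by exists y => //=; rewrite eq_sym xy xyp subrr eqxx.
  rewrite rootE dG // prodf_seq_eq0 => /hasP[v vv /=]; rewrite subr_eq0 => H.
  by exists v.
(* A bad prime p is sent to some v other than w with v^p = w^p. *)
pose phi p := head w [seq y <- zs | (y != w) && (w ^+ p == y ^+ p)].
have phiP p : p \in ps -> [/\ phi p \in zs, phi p != w & w ^+ p = phi p ^+ p].
  move=> /bad[y yy yP]; rewrite /phi.
  have : y \in [seq y <- zs | (y != w) && (w ^+ p == y ^+ p)] by rewrite mem_filter yP.
  case E : [seq y <- zs | _] => [|v s] // _ /=.
  have : v \in v :: s by rewrite mem_head.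
  by rewrite -E mem_filter => /andP[/andP[-> /eqP ->] ->].
have iphi : {in ps &, injective phi}.
  move=> p q pps qps E; apply/eqP/negPn/negP => pq.
  have [vz vw vp] := phiP p pps; have [_ _ vq] := phiP q qps; rewrite -E in vq.
  set v := phi p in vz vw vp vq.
  have [pp _] := psP p pps; have [qp _] := psP q qps.
  have cop : coprime p q by rewrite prime_coprime // dvdn_prime2.
  (* Since v/w has order dividing both p and q, it is 1. *)
  case: (egcdnP q (prime_gt0 pp)) => a b; rewrite (eqP cop) => ab _.
  have wq0 : w ^+ (b * q) != 0 by rewrite expf_neq0 ?zn0.
  case/negP: vw; apply/eqP/(mulfI wq0).
  rewrite {1}mulnC {1}exprM vq -exprM mulnC -!exprSr -addn1 -ab.
  by rewrite mulnC !exprM vp.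
have : (size (map phi ps) <= size (rem w zs))%N.
  apply: uniq_leq_size; first by rewrite map_inj_in_uniq.
  by move=> _ /mapP[p pps ->]; have [? ? _] := phiP p pps; rewrite mem_rem_uniq // inE; apply/andP.
rewrite size_map size_rem //; have : (0 < size zs)%N by rewrite lt0n size_eq0.
by move=> n0 H; have := leq_trans szp H; rewrite -ltnS prednK // ltnn.
Qed.

(** The power sums of order below 2n determine the sum over the set of any
    polynomial of degree below 2n; test it on one that vanishes on both sets except at
    a single point. *)
Lemma power_sums_inj zs xs : uniq zs -> uniq xs -> size zs = size xs ->
  (forall k, (k < 2 * size zs)%N -> \sum_(z <- zs) z ^+ k = \sum_(z <- xs) z ^+ k) ->
  zs =i xs.
Proof.
move=> uz ux sz ps.
suff H (as_ bs : seq C) : uniq as_ -> size as_ = size bs ->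
    (forall k, (k < 2 * size as_)%N -> \sum_(z <- as_) z ^+ k = \sum_(z <- bs) z ^+ k) ->
    {subset as_ <= bs}.
  move=> z; apply/idP/idP; first exact: H.
  by apply: H => // k; rewrite -sz => /ps.
move=> ua sab psab z za; apply/negPn/negP => zb.
have n0 : (0 < size as_)%N by case: (as_) za.
(* This polynomial vanishes on both sets except at z, and has degree 2n - 1. *)
pose q := \prod_(y <- bs) ('X - y%:P) * \prod_(y <- rem z as_) ('X - y%:P).
have szq : (size q <= 2 * size as_)%N.
  apply: leq_trans (size_polyMleq _ _) _; rewrite !size_prod_XsubC size_rem // -sab.
  by rewrite prednK // addSn /= addnn -mul2n.
have ev (ys : seq C) : \sum_(y <- ys) q.[y] = \sum_(k < 2 * size as_) q`_k * \sum_(y <- ys) y ^+ k.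
  under eq_bigr => y _ do rewrite (horner_coef_wide _ szq).
  by rewrite exchange_big /=; apply: eq_bigr => k _; rewrite mulr_sumr.
have E : \sum_(y <- as_) q.[y] = \sum_(y <- bs) q.[y].
  by rewrite !ev; apply: eq_bigr => k _; rewrite psab.
have Eb : \sum_(y <- bs) q.[y] = 0.
  rewrite big_seq big1 // => y yb; rewrite hornerM.
  have /rootP -> : root (\prod_(y <- bs) ('X - y%:P)) y by rewrite root_prod_XsubC.
  by rewrite mul0r.
move: E; rewrite Eb (bigD1_seq z) //= [X in _ + X]big_seq_cond big1 ?addr0; last first.
  move=> y /andP[ya yz]; rewrite hornerM.
  have /rootP -> : root (\prod_(y <- rem z as_) ('X - y%:P)) y.
    by rewrite root_prod_XsubC mem_rem_uniq // inE yz.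
  by rewrite mulr0.
move/eqP; rewrite hornerM mulf_eq0 -![_ == 0]/(root _ _) !root_prod_XsubC (negbTE zb).
by rewrite mem_rem_uniq // inE eqxx.
Qed.

Lemma power_sum_int zs k : galois_set zs -> exists m : int, \sum_(z <- zs) z ^+ k = m%:~R.
Proof.
move=> [[uz _ _ _ _] [g [gm gE]]]; exists (\tr (mulmod_mx g zs 'X^k)).
rewrite -(sum_conj_int gm uz gE); apply: eq_bigr => z _.
by rewrite map_polyXn hornerXn.
Qed.

Lemma mahler1_le_mahler zs z : z \in zs -> mahler1 z <= mahler zs.
Proof.
rewrite /mahler; elim: zs => // x zs IH; rewrite in_cons big_cons => /orP[/eqP <-|/IH H].
  by rewrite ler_peMr ?(le_trans ler01 (mahler1_ge1 _)) //; exact: mahler_ge1.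
by apply: le_trans H _; rewrite ler_peMl ?mahler1_ge1 ?(le_trans ler01 (mahler_ge1 zs)).
Qed.

Lemma norm_power_sum_le zs k m : (k <= m)%N ->
  `|\sum_(z <- zs) z ^+ k| <= (size zs)%:R * mahler zs ^+ m.
Proof.
move=> km; apply: le_trans (ler_norm_sum _ _ _) _.
have -> : (size zs)%:R * mahler zs ^+ m = \sum_(z <- zs) mahler zs ^+ m.
  by rewrite big_const_seq count_predT iter_addr_0 mulr_natl.
rewrite big_seq [leRHS]big_seq; apply: ler_sum => z zz; rewrite normrX.
have M1 := mahler_ge1 zs; have M0 := le_trans ler01 M1.
apply: (@le_trans _ _ (mahler zs ^+ k)); last by rewrite ler_weXn2l.
rewrite lerXn2r ?nnegrE //; exact: le_trans (norm_le_mahler1 z) (mahler1_le_mahler zz).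
Qed.

End Galois.

(** * Conjugates of an algebraic integer *)

(** The minimal polynomial over Q divides every rational polynomial which vanishes
    at one of its roots, hence it is separable. *)
Lemma galois_set_of_Aint (a : algC) : a \in Aint -> a != 0 ->
  exists zs : seq algC, galois_set zs /\ a \in zs /\
    minCpoly a = \prod_(z <- zs) ('X - z%:P).
Proof.
move=> aI a0; have [p [pE pm] pP] := minCpolyP a.
have key (z : algC) (q : {poly rat}) :
    root (map_poly ratr p) z -> root (map_poly ratr q) z -> p %| q.
  move=> pz qz.
  have : root (map_poly ratr (gcdp p q)) z by rewrite gcdp_map root_gcd pz qz.
  have pg : p = (p %/ gcdp p q) * gcdp p q by rewrite divpK // dvdp_gcdl.
  have : root (map_poly ratr p) a by rewrite -pE root_minCpoly.
  rewrite {1}pg rmorphM /= rootM !pP => /orP[dv|dv] gz; last first.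
    exact: dvdp_trans dv (dvdp_gcdr _ _).
  exfalso.
  have r0 : p %/ gcdp p q != 0.
    by apply: contraTneq pm => r0; rewrite pg r0 mul0r monicE lead_coef0 eq_sym oner_eq0.
  have g0 : gcdp p q != 0 by rewrite gcdp_eq0 (negbTE (monic_neq0 pm)).
  have := dvdp_leq r0 dv; rewrite {1}pg size_mul //.
  have : (1 < size (gcdp p q))%N.
    rewrite -(size_map_poly (ratr : rat -> algC)); apply: root_size_gt1 gz.
    by rewrite map_poly_eq0.
  have : (0 < size (p %/ gcdp p q)%R)%N by rewrite size_poly_gt0.
  case: (size _) => // i _; case: (size _) => [//|[//|j]] _.
  by rewrite addnS /= -{2}[i.+1]addn0 leq_add2l.
have [r rE] := closed_field_poly_normal (minCpoly a).
rewrite (monicP (minCpoly_monic a)) scale1r in rE.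
have rr z : (z \in r) = root (map_poly ratr p) z by rewrite -pE rE root_prod_XsubC.
have ur : uniq r.
  apply/negPn/negP => nu.
  have [z zz dz] : exists2 z, z \in r & root (\prod_(y <- r) ('X - y%:P))^`() z.
    case: r {rE rr} nu => // z0 r0.
    move/(uniqPn 0) => [i [j [ij jn E]]].
    set r := z0 :: r0 in jn E *; exists r`_i; first by rewrite mem_nth // (ltn_trans ij jn).
    rewrite (big_nth 0) big_mkord (bigD1 (Ordinal (ltn_trans ij jn))) //=.
    rewrite (bigD1 (Ordinal jn)) /=; last by rewrite -val_eqE /= gtn_eqF.
    by rewrite E rootE derivM hornerD !hornerM hornerXsubC subrr !(mul0r, mulr0) addr0.
  have : p %| p^`().
    by apply: (key z); rewrite -?rr // -deriv_map -pE rE.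
  have p'0 : p^`() != 0.
    have := size_minCpoly a; rewrite pE size_map_poly => p1.
    apply/eqP => p'0; have := congr1 (fun q : {poly rat} => q`_(size p).-2) p'0.
    rewrite coef_deriv coef0; case E : (size p) p1 => [//|[//|k]] _ /=.
    have -> : p`_k.+1 = 1 by rewrite -(monicP pm) lead_coefE E.
    by move/eqP; rewrite pnatr_eq0.
  move/(dvdp_leq p'0); rewrite leqNgt lt_size_deriv ?monic_neq0 //.
have ZQ (h : {poly int}) : map_poly (intr : int -> algC) h = map_poly ratr (map_poly intr h).
  rewrite -map_poly_comp; apply: eq_map_poly => c /=; by rewrite ratr_int.
exists r; split; last by split=> //; rewrite rr -pE root_minCpoly.
have [g gE] : exists g : {poly int}, minCpoly a = map_poly intr g.
  by have [g gE] := floorpP aI; exists g.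
have gm : g \is monic.
  have := minCpoly_monic a; rewrite gE !monicE (lead_coef_map_inj (intr_inj : injective (intr : int -> algC))) //.
  by move=> /eqP E; apply/eqP/(@intr_inj algC); rewrite E.
split; last by exists g; rewrite -gE.
split=> //.
- rewrite rr; apply/negP => r0.
  have : p %| 'X by apply: (key 0); rewrite // map_polyX rootX.
  by rewrite -pP map_polyX rootX (negbTE a0).
- by apply/eqP => r0; have := size_minCpoly a; rewrite rE r0 big_nil size_poly1.
- by exists g => z; rewrite -gE rE -topredE /= root_prod_XsubC.
- move=> h z z'; rewrite !rr ZQ => pz pz' hz.
  have /dvdpP[q ->] := key z _ pz hz.
  by rewrite rmorphM rootM pz' orbT.
Qed.

(** * Many primes below a power of two *)

Section PrimeCounting.
Local Open Scope nat_scope.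

Lemma central_bin_ge N : 2 ^ N <= 'C(N.*2, N).
Proof.
elim: N => [//|N IH].
rewrite doubleS expnS binS mul2n -addnn; apply: leq_trans (leq_add IH IH) _.
apply: leq_add; first by rewrite binS leq_addl.
by case: (N) => // M; rewrite binS leq_addr.
Qed.

(** By Legendre's formula the exponent of p is a sum of terms 0 or 1, one for each
    power of p up to 2N. *)
Lemma logn_central_bin p N : prime p -> 0 < N ->
  p ^ logn p 'C(N.*2, N) <= N.*2.
Proof.
move=> pp N0; have p1 := prime_gt1 pp; have p0 := prime_gt0 pp.
set L := trunc_log p N.*2.
have N20 : 0 < N.*2 by lia.
apply: leq_trans (trunc_logP p1 N20); rewrite leq_exp2l //.
have NN : N <= N.*2 by lia.
have := bin_fact NN; rewrite (_ : N.*2 - N = N); last by lia.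
move/(congr1 (logn p)); rewrite !lognM ?muln_gt0 ?fact_gt0 ?bin_gt0 // !logn_fact //.
have -> : \sum_(1 <= k < N.+1) N %/ p ^ k = \sum_(1 <= k < N.*2.+1) N %/ p ^ k.
  rewrite [RHS](big_cat_nat (n := N.+1)) //=.
  rewrite [X in _ = _ + X]big_nat_cond [X in _ = _ + X]big1 ?addn0 // => k; rewrite andbT => /andP[Nk _].
  by rewrite divn_small // (leq_trans Nk) // ltnW // ltn_expl.
set S := \sum_(_ <= _ < _) N %/ _.
have : \sum_(1 <= k < N.*2.+1) N.*2 %/ p ^ k <= S + S + L.
  have -> : L = \sum_(1 <= k < N.*2.+1) (k <= L).
    rewrite (big_cat_nat (n := L.+1)) //=; last first.
      by rewrite ltnS; apply: leq_trans (trunc_logP p1 N20); rewrite ltnW // ltn_expl.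
    rewrite big_nat_cond (eq_bigr (fun=> 1)); last by move=> k; rewrite andbT ltnS => /andP[_ ->].
    rewrite -big_nat_cond sum_nat_const_nat muln1 subn1 /=.
    rewrite big_nat_cond big1 ?addn0 // => k; rewrite andbT => /andP[Lk _].
    by rewrite leqNgt Lk.
  rewrite /S -!big_split /=; apply: leq_sum => k _.
  have pk : 0 < p ^ k by rewrite expn_gt0 p0.
  have [kL|Lk] := leqP k L.
    rewrite addn1 -ltnS -addnn ltn_divLR // ?addnn.
    have := ltn_ceil N pk; lia.
  by rewrite divn_small //; exact: leq_trans (trunc_log_ltn _ p1) (leq_pexp2l p0 Lk).
lia.
Qed.

(** The central binomial coefficient is a product of prime powers, each at most 2N. *)
Lemma count_primes_ge k : 0 < k ->
  2 ^ k.-1 <= k * size [seq p <- iota 0 (2 ^ k).+1 | prime p].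
Proof.
case: k => // k _; rewrite /=; set N := 2 ^ k.
have N0 : 0 < N by rewrite expn_gt0.
have NE : 2 ^ k.+1 = N.*2 by rewrite expnS mul2n.
rewrite NE -(leq_exp2l _ _ (isT : 1 < 2)).
apply: leq_trans (central_bin_ge N) _.
have C0 : 0 < 'C(N.*2, N) by rewrite bin_gt0 -addnn leq_addr.
rewrite [leqLHS](prod_prime_decomp C0) prime_decompE big_map /=.
rewrite expnM NE.
have sub : {subset primes 'C(N.*2, N) <= [seq p <- iota 0 N.*2.+1 | prime p]}.
  move=> p pC; rewrite mem_filter mem_iota.
  move: (pC); rewrite mem_primes => /and3P[pp _ pd].
  rewrite pp /= add0n ltnS; apply: leq_trans (logn_central_bin pp N0).
  by rewrite -{1}[p]expn1 leq_exp2l ?prime_gt1 // logn_gt0.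
apply: (@leq_trans (\prod_(p <- primes 'C(N.*2, N)) N.*2)).
  rewrite big_seq [leqRHS]big_seq; apply: leq_prod => p.
  by rewrite mem_primes => /and3P[pp _ _]; rewrite logn_central_bin.
rewrite big_const_seq iter_muln_1 count_predT leq_exp2l; last by lia.
by apply: uniq_leq_size; [exact: primes_uniq|].
Qed.

(** At most 4n of the 5n + 1 primes are below 4n. *)
Lemma primes_between n k : k * (5 * n).+1 <= 2 ^ k.-1 -> 0 < k ->
  exists ps : seq nat, [/\ uniq ps, n <= size ps &
     forall p, p \in ps -> prime p /\ 4 * n <= p <= 2 ^ k].
Proof.
move=> kn k0; have := count_primes_ge k0; set ps := [seq p <- iota 0 _ | _] => H.
exists [seq p <- ps | 4 * n <= p]; split.
- by rewrite !filter_uniq // iota_uniq.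
- have nps : (5 * n).+1 <= size ps by rewrite -(leq_pmul2l k0) (leq_trans kn).
  have sE := count_predC (fun p => 4 * n <= p) ps.
  have : count (predC (fun p => 4 * n <= p)) ps <= size (iota 0 (4 * n)).
    rewrite -size_filter; apply: uniq_leq_size; first by rewrite !filter_uniq // iota_uniq.
    by move=> p; rewrite mem_filter /= -ltnNge mem_iota add0n => /andP[].
  rewrite size_iota size_filter; lia.
- move=> p; rewrite !mem_filter mem_iota add0n ltnS => /andP[-> /andP[-> /andP[_ ->]]].
  by [].
Qed.

End PrimeCounting.

(** * Counting in products of finite sets *)

Section CountFamily.
Local Open Scope nat_scope.
Variables (I T : finType).
Implicit Types (A : I -> {pred T}) (S : {set I}) (E : {set {ffun I -> T}}).

Lemma card_family_prod A : #|family A| = \prod_i #|A i|.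
Proof. by rewrite card_family foldrE big_map enumT. Qed.

Definition overwrite S (e c : {ffun I -> T}) : {ffun I -> T} :=
  [ffun i => if i \in S then e i else c i].

Lemma card_overwrite_le A S E e : {subset E <= family A} ->
  #|[set overwrite S e c | c in E]| <= \prod_(i | i \notin S) #|A i|.
Proof.
move=> EA; pose B i : {pred T} := if i \in S then (pred1 (e i) : {pred T}) else A i.
have -> : \prod_(i | i \notin S) #|A i| = #|family B|.
  rewrite card_family_prod [RHS](bigID (mem S)) /= [X in _ = X * _]big1 ?mul1n; last first.
    by move=> i iS; rewrite /B iS card1.
  by apply: eq_bigr => i /negbTE iS; rewrite /B iS.
apply: subset_leq_card; apply/fintype.subsetP => _ /imsetP[c cE ->]; apply/familyP => i.
rewrite ffunE /B; case: ifP => iS; first by rewrite inE.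
by have /familyP := EA c cE.
Qed.

(** Forgetting the coordinates in [S] is injective on [E]. *)
Lemma card_determined_off A S E : {subset E <= family A} ->
  (forall c c', c \in E -> c' \in E -> (forall i, i \notin S -> c i = c' i) -> c = c') ->
  #|E| * \prod_(i in S) #|A i| <= \prod_i #|A i|.
Proof.
move=> EA inj; have [->|[e eE]] := set_0Vmem E; first by rewrite cards0.
rewrite [leqRHS](bigID (mem S)) /= mulnC leq_mul2l; apply/orP; right.
rewrite -(card_in_imset (f := overwrite S e)); first exact: card_overwrite_le.
move=> c c' cE c'E eq; apply: inj => // i iS.
by have := congr1 (fun f : {ffun I -> T} => f i) eq; rewrite !ffunE (negbTE iS).
Qed.

Lemma card_fibers_le (R : realDomainType) E (f : {ffun I -> T} -> {ffun I -> T}) (w : R) :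
  (forall e, (#|[set c in E | f c == e]|%:R <= w)%R) -> (#|E|%:R <= #|f @: E|%:R * w)%R.
Proof.
move=> H; rewrite -sum1_card (partition_big f (fun e => e \in f @: E)) /=; last first.
  by move=> c cE; apply: imset_f.
rewrite natr_sum mulr_natl -sumr_const; apply: ler_sum => e _; apply: le_trans (H e).
rewrite ler_nat -sum1_card; apply: eq_leq; apply: eq_bigl => c; by rewrite !inE.
Qed.

End CountFamily.

(** * Concentration of sums of independent uniform variables *)

Section BinomialBound.
Local Open Scope nat_scope.

Lemma central_bin_sq m : (m.*2.+1 * 'C(m.*2, m) ^ 2 <= 4 ^ m.*2)%N.
Proof.
elim: m => [//|m IH].
have E1 : (m.+1 * 'C(m.*2.+2, m.+1) = m.*2.+2 * 'C(m.*2.+1, m))%N by rewrite mul_bin_diag.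
have E2 : (m.+1 * 'C(m.*2.+1, m) = m.*2.+1 * 'C(m.*2, m))%N.
  have := mul_bin_down m.*2.+1 m.
  by have -> : (m.*2.+1 - m = m.+1)%N by lia.
rewrite doubleS.
have E : (m.+1 * 'C(m.*2.+2, m.+1) = 2 * m.*2.+1 * 'C(m.*2, m))%N.
  by rewrite E1 -mulnA -E2; lia.
have m2 : (0 < m.+1 ^ 2)%N by rewrite expn_gt0.
rewrite -(leq_pmul2r m2) -mulnA -expnMn (mulnC 'C(_, _)) E !expnMn !(expnS 4).
move: IH; rewrite -mul2n; set B := 'C(_, _); set F := (4 ^ _)%N => IH.
have : (2 * m).+2.+1 * (2 ^ 2 * (2 * m).+1 ^ 2 * B ^ 2)
   <= 4 * (4 * F) * m.+1 ^ 2.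
  have -> : (2 * m).+2.+1 * (2 ^ 2 * (2 * m).+1 ^ 2 * B ^ 2) =
     (4 * (2 * m).+3 * (2 * m).+1) * ((2 * m).+1 * B ^ 2) by lia.
  have -> : 4 * (4 * F) * m.+1 ^ 2 = (16 * m.+1 ^ 2) * F by lia.
  apply: leq_mul => //; lia.
by [].
Qed.

Lemma bin_le_half n k : ('C(n, k) <= 'C(n, n./2))%N.
Proof.
have up j : (j <= n./2)%N -> ('C(n, n./2 - j) <= 'C(n, n./2))%N.
  elim: j => [|j IH] jn; first by rewrite subn0.
  apply: leq_trans (IH (ltnW jn)).
  set m := (n./2 - j.+1)%N; have -> : (n./2 - j)%N = m.+1 by rewrite /m; lia.
  have := mul_bin_left n m; have : (m.+1 <= n - m)%N by rewrite /m; lia.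
  have m0 : (0 < m.+1)%N by [].
  move=> mn E; rewrite -(leq_pmul2l m0) E leq_mul2r mn orbT //.
have [kn|nk] := leqP k n./2.
  have := up (n./2 - k)%N (leq_subr _ _); by rewrite subKn.
have [kn|kn] := leqP k n; last by rewrite bin_small.
rewrite -bin_sub //; have := up (n./2 - (n - k))%N (leq_subr _ _).
rewrite subKn //; lia.
Qed.

(** That is, binomial coefficients are O(2^n / sqrt n). *)
Lemma bin_sq_le n k : (n.+1 * 'C(n, k) ^ 2 <= 4 ^ n)%N.
Proof.
apply: (@leq_trans (n.+1 * 'C(n, n./2) ^ 2)).
  by rewrite leq_mul2l leq_exp2r // bin_le_half orbT.
have [m [->|->]] : exists m, n = m.*2 \/ n = m.*2.+1.
  by exists n./2; rewrite -{1 3}(odd_double_half n); case: (odd n); [right|left].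
- by rewrite doubleK central_bin_sq.
- have -> : m.*2.+1./2 = m by rewrite -[m.*2.+1]/(true + m.*2)%N half_bit_double.
  have E1 : 'C(m.*2.+2, m.+1) = (2 * 'C(m.*2.+1, m))%N.
    rewrite binS -{1}[m.+1](_ : m.*2.+1 - m = m.+1)%N; last by lia.
    rewrite bin_sub; lia.
  have := central_bin_sq m.+1; rewrite doubleS E1 expnMn (expnS 4); set F := (4 ^ _); set B := _ ^ 2.
  lia.
Qed.

End BinomialBound.

Section LittlewoodOfford.
Variable R : realType.
Implicit Types (p q A B : {poly R}).

Lemma coefM_le A B (mx : R) v :
  (forall i, A`_i <= mx) -> (forall i, 0 <= B`_i) -> 0 <= mx -> (A * B)`_v <= mx * B.[1].
Proof.
move=> Am B0 mx0.
have sB : (size B <= maxn v.+1 (size B))%N by rewrite leq_maxr.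
rewrite (horner_coef_wide _ sB) coefMr.
under [X in _ <= _ * X]eq_bigr => i _ do rewrite expr1n mulr1.
rewrite (big_ord_widen _ (fun j => A`_(v - j) * B`_j) (leq_maxl v.+1 (size B))) big_mkcond /=.
rewrite mulr_sumr; apply: ler_sum => i _; case: ifP => _; last by rewrite mulr_ge0.
by rewrite ler_wpM2r.
Qed.

Definition geom n : {poly R} := \sum_(j < n) 'X^j.

(** Pairing the values 2i and 2i+1 of a uniform variable on 0, ..., 2K makes it, with
    one exceptional value 2K, the sum of a fair bit and another variable. *)
Lemma geom_split K :
  geom K.*2.+1 = 'X^(K.*2) + (1 + 'X) * \sum_(j < K) 'X^(j.*2).
Proof.
elim: K => [|K IH]; first by rewrite /geom big_ord1 big_ord0 mulr0 addr0.
have gS n : geom n.+1 = geom n + 'X^n by rewrite /geom big_ord_recr.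
rewrite doubleS 2!gS IH big_ord_recr /= !exprS; ring.
Qed.

Lemma coef_expD1X j k : ((1 + 'X) ^+ j : {poly R})`_k = 'C(j, k)%:R.
Proof.
rewrite addrC exprDn coef_sum; under eq_bigr => i _ do rewrite expr1n mulr1 coefMn coefXn.
have [jk|kj] := ltnP j k.
  rewrite bin_small // big1 // => i _; rewrite gtn_eqF ?mul0rn //.
  by rewrite (leq_ltn_trans _ jk) // leq_subr.
have H : (j - k < j.+1)%N by rewrite ltnS leq_subr.
rewrite (bigD1 (Ordinal H)) //= subKn // eqxx big1 ?addr0; last first.
  move=> i; rewrite -val_eqE /= => ik; case: eqP => [E|]; last by rewrite mul0rn.
  by move: ik; rewrite E subKn ?eqxx // -ltnS.
by rewrite bin_sub.
Qed.

(** A linearised form of the bound 2^j / sqrt (j+1): by the arithmetic-geometric mean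
    inequality, s / sqrt (j+1) <= (1 + s^2 / (j+1)) / 2.  The right-hand side can be
    averaged exactly against a binomial distribution. *)
Lemma bin_le_amgm (s : R) j k : 0 < s ->
  'C(j, k)%:R <= 2 ^+ j / (s *+ 2) * (1 + s ^+ 2 / j.+1%:R).
Proof.
move=> s0; set t := Num.sqrt (j.+1%:R : R).
have t0 : 0 < t by rewrite sqrtr_gt0 ltr0n.
have t2 : t ^+ 2 = j.+1%:R by rewrite sqr_sqrtr ?ler0n.
have Ct : 'C(j, k)%:R * t <= 2 ^+ j.
  rewrite -(@ler_pXn2r _ 2) ?nnegrE ?mulr_ge0 ?ler0n ?exprn_ge0 ?(ltW t0) //.
  rewrite exprMn t2 -exprM mulnC exprM -!natrX -natrM ler_nat mulnC.
  exact: bin_sq_le.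
rewrite -t2 -(ler_pM2r t0); apply: le_trans Ct _.
rewrite -mulrA -mulrA ler_peMr ?exprn_ge0 ?ler0n //.
have -> : (s *+ 2)^-1 * (1 + s ^+ 2 / t ^+ 2) * t = (t ^+ 2 + s ^+ 2) / (s * t *+ 2).
  by field; rewrite ?gt_eqF.
rewrite ler_pdivlMr ?mul1r; last by rewrite pmulrn_lgt0 // mulr_gt0.
by have := sqr_ge0 (s - t); rewrite sqrrB; lra.
Qed.

(** Among N independent uniform variables on 0, ..., 2K, suppose that j avoid the
    exceptional value 2K.  Their fair bits bound the concentration of the sum by
    C(j, j/2) / 2^j.  It remains to average over j, where
    C(N, j) (N+1) / (j+1) = C(N+1, j+1). *)
Lemma coef_geom_exp_le K N v : (0 < K)%N ->
  (geom K.*2.+1 ^+ N)`_v <= 2 * (K.*2.+1)%:R ^+ N / Num.sqrt N.+1%:R.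
Proof.
move=> K0; set s := Num.sqrt _.
have s0 : 0 < s by rewrite sqrtr_gt0 ltr0n.
have s2 : s ^+ 2 = N.+1%:R by rewrite sqr_sqrtr ?ler0n.
set Q := \sum_(j < K) 'X^(j.*2) : {poly R}.
have Q0 i : 0 <= Q`_i.
  by rewrite coef_sum sumr_ge0 // => j _; rewrite coefXn ler0n.
have Qe j i : 0 <= (Q ^+ j)`_i.
  elim: j i => [|j IH] i; first by rewrite expr0 coef1 ler0n.
  by rewrite exprS coefM sumr_ge0 // => k _; rewrite mulr_ge0.
have Q1 : Q.[1] = K%:R.
  rewrite horner_sum; under eq_bigr => i _ do rewrite hornerXn expr1n.
  by rewrite sumr_const card_ord.
pose b j : R := 2 ^+ j / (s *+ 2) * (1 + s ^+ 2 / j.+1%:R).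
have b0 j : 0 <= b j.
  by rewrite mulr_ge0 ?divr_ge0 ?exprn_ge0 ?mulrn_wge0 ?(ltW s0) ?addr_ge0 ?divr_ge0 ?exprn_ge0 ?(ltW s0).
have H1 : (geom K.*2.+1 ^+ N)`_v <= \sum_(j < N.+1) (b j * K%:R ^+ j) *+ 'C(N, j).
  rewrite geom_split exprDn coef_sum; apply: ler_sum => j _.
  rewrite coefMn lerMn2r -exprM coefXnM exprMn.
  case: ifP => _; first by rewrite mulr_ge0 ?exprn_ge0 ?orbT.
  rewrite -[K%:R]Q1 -horner_exp coefM_le ?orbT // => i.
  by rewrite coef_expD1X bin_le_amgm.
apply: le_trans H1 _.
have -> : \sum_(j < N.+1) (b j * K%:R ^+ j) *+ 'C(N, j) =
   (s *+ 2)^-1 * (\sum_(j < N.+1) (K.*2)%:R ^+ j *+ 'C(N, j)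
                + \sum_(j < N.+1) (K.*2)%:R ^+ j *+ 'C(N.+1, j.+1)).
  rewrite -big_split /= mulr_sumr; apply: eq_bigr => j _.
  have CE : 'C(N.+1, j.+1)%:R = 'C(N, j)%:R * N.+1%:R / j.+1%:R :> R.
    have j0 : j.+1%:R != 0 :> R by rewrite pnatr_eq0.
    apply: (mulIf j0); rewrite divfK // -!natrM mulnC -mul_bin_diag mulnC; congr _%:R.
  rewrite -(mulr_natr (b j * _)) -(mulr_natr (_ ^+ j) 'C(N, j)) -(mulr_natr (_ ^+ j) 'C(N.+1, _)) CE.
  rewrite /b s2 -mul2n natrM exprMn -(mulr_natr s); field.
  by rewrite (gt_eqF s0) addrC natr1 pnatr_eq0.
set x : R := (K.*2)%:R.
have x2 : 2 <= x by rewrite /x ler_nat; lia.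
have xE : (K.*2.+1)%:R = 1 + x by rewrite /x -natr1 addrC.
rewrite xE; set T := (1 + x) ^+ N.
have -> : \sum_(j < N.+1) x ^+ j *+ 'C(N, j) = T.
  by rewrite /T exprDn; apply: eq_bigr => j _; rewrite expr1n mul1r.
set S := \sum_(j < N.+1) _.
have T0 : 0 <= T by rewrite exprn_ge0 //; lra.
have xS : x * S <= T * (1 + x).
  rewrite /T -exprSr exprDn big_ord_recl /= mulr_sumr.
  rewrite -[X in X <= _]add0r; apply: lerD; first by rewrite expr1n mul1r expr0 bin0 mulr1n ler01.
  by apply: ler_sum => j _; rewrite expr1n mul1r /bump /= add1n exprS mulrnAr.
have S2 : S <= 3 / 2 * T.
  have x0 : 0 < x by lra.
  rewrite -(ler_pM2l x0); apply: le_trans xS _; nra.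
rewrite ler_pdivlMr //.
have -> : (s *+ 2)^-1 * (T + S) * s = (T + S) / 2 by field; rewrite (gt_eqF s0).
lra.
Qed.

Section Fibers.
Variables (I : finType) (K : nat).
Hypothesis K0 : (0 < K)%N.
Local Notation T := 'I_(K.*2.+1).
Implicit Types (S : {set I}) (c e : {ffun I -> T}) (E : {set {ffun I -> T}}).

Definition free_on S e (i : I) : {pred T} :=
  if i \in S then (predT : {pred T}) else pred1 (e i).

(** The right-hand side is the generating function of the sum of the coordinates in [S]. *)
Lemma card_sum_fiber S e v :
  #|[set c | (c \in family (free_on S e)) && ((\sum_(i in S) c i)%N == v)]|%:R
    = (geom K.*2.+1 ^+ #|S|)`_v.
Proof.
pose F (i : I) (j : T) : {poly R} := if i \in S then 'X^j else 1.
have P : \prod_i \sum_(j in free_on S e i) F i j = geom K.*2.+1 ^+ #|S|.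
  rewrite (bigID (mem S)) /= [X in _ * X]big1 ?mulr1; last first.
    move=> i /negbTE iS; rewrite /F iS /free_on iS.
    by rewrite (big_pred1 (e i)).
  rewrite -prodr_const; apply: eq_bigr => i iS.
  by rewrite /F /free_on iS.
rewrite -P bigA_distr_big_dep coef_sum -sum1_card natr_sum [RHS](bigID (fun c => (\sum_(i in S) c i)%N == v)) /=.
have FE c : \prod_i F i (c i) = 'X^(\sum_(i in S) c i).
  rewrite (bigID (mem S)) /= [X in _ * X]big1 ?mulr1; last by move=> i /negbTE iS; rewrite /F iS.
  rewrite -prodrXr; apply: eq_bigr => i iS; by rewrite /F iS.
rewrite [X in _ = _ + X]big1 ?addr0; last first.
  by move=> c /andP[_ cv]; rewrite FE coefXn eq_sym (negbTE cv).
apply: eq_big => c; first by rewrite !inE.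
by rewrite inE => /andP[_ /eqP <-]; rewrite FE coefXn eqxx.
Qed.

(** If the coordinates outside [S] determine the sum of those in [S], then at most a
    proportion O(1 / sqrt #|S|) of the choices in [S] is compatible with them. *)
Lemma card_sum_determined S E :
  (forall c c', c \in E -> c' \in E -> (forall i, i \notin S -> c i = c' i) ->
     \sum_(i in S) c i = \sum_(i in S) c' i)%N ->
  forall e, #|E|%:R <= #|[set overwrite S e c | c in E]|%:R
     * (2 * (K.*2.+1)%:R ^+ #|S| / Num.sqrt #|S|.+1%:R) :> R.
Proof.
move=> H e; apply: card_fibers_le => e1.
have [->|[c]] := set_0Vmem [set c in E | overwrite S e c == e1].
  by rewrite cards0 mulr_ge0 ?invr_ge0 ?sqrtr_ge0 ?mulr_ge0 ?exprn_ge0.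
rewrite inE => /andP[cE /eqP ce].
apply: le_trans (coef_geom_exp_le #|S| (\sum_(i in S) c i)%N K0).
rewrite -(card_sum_fiber S c) ler_nat; apply: subset_leq_card; apply/fintype.subsetP => c'.
rewrite !inE => /andP[c'E /eqP c'e].
have off i : i \notin S -> c' i = c i.
  move=> iS; have := congr1 (fun f : {ffun I -> T} => f i) (etrans c'e (esym ce)).
  by rewrite !ffunE (negbTE iS).
apply/andP; split; last by apply/eqP; exact: H.
by apply/familyP => i; rewrite /free_on; case: ifP => // /negbT iS; rewrite inE off.
Qed.
End Fibers.

End LittlewoodOfford.

(** * The box of coefficient vectors *)

Section Box.
Variables (d K : nat).
Local Notation T := 'I_(K.*2.+1).
Implicit Types (c : {ffun 'I_d -> T}).

(** The integers of absolute value at most K are encoded as ordinals below 2K + 1. *)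
Definition centre (v : T) : int := (v : nat)%:Z - K%:Z.

Definition ffpoly c : {poly int} := 'X^d + rVpoly (\row_i centre (c i)).

Lemma coef_ffpoly c (i : 'I_d) : (ffpoly c)`_i = centre (c i).
Proof. by rewrite coefD coefXn ltn_eqF // add0r coef_rVpoly_ord mxE. Qed.

Lemma ffpolyB c c' : ffpoly c - ffpoly c' = rVpoly (\row_i (centre (c i) - centre (c' i))).
Proof.
rewrite /ffpoly opprD addrACA subrr add0r -linearB; congr rVpoly.
by apply/rowP => i; rewrite !mxE.
Qed.

Lemma norm_centreB_le (v w : T) : `|centre v - centre w| <= (2 * K)%:Z.
Proof. by rewrite /centre; case: v => v /= vK; case: w => w /= wK; lia. Qed.

Lemma norm_centre_le (v : T) : `|centre v| <= K%:Z.
Proof. by rewrite /centre; case: v => v /= vK; lia. Qed.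

Lemma ffpoly_monic c : ffpoly c \is monic.
Proof.
rewrite monicE /ffpoly lead_coefDl ?lead_coefXn //.
by rewrite size_polyXn ltnS /rVpoly size_poly.
Qed.

Lemma size_ffpoly c : size (ffpoly c) = d.+1.
Proof. by rewrite size_polyDl size_polyXn // ltnS size_poly. Qed.

(** The ordinal K encodes the value 0, which is excluded for the constant term. *)
Definition adm_coef (i : 'I_d) : {pred T} := [pred v : T | (i == 0%N :> nat) ==> (v != K :> nat)].

Definition adm : {set {ffun 'I_d -> T}} := [set c in family adm_coef].

Lemma card_adm_coef_full (i : 'I_d) : (i : nat) != 0%N -> #|adm_coef i| = (2 * K).+1.
Proof.
move=> i0; rewrite (eq_card (B := predT)) ?card_ord ?mul2n //.
by move=> v; rewrite !inE (negbTE i0).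
Qed.

Lemma card_adm_coef0 (i : 'I_d) : (i : nat) = 0%N -> #|adm_coef i| = (2 * K)%N.
Proof.
move=> i0; have KK : (K < K.*2.+1)%N by lia.
have := cardC1 (Ordinal KK); rewrite card_ord /= => E.
rewrite mul2n -[RHS]E; apply: eq_card => v; rewrite !inE i0 eqxx /=.
by rewrite -val_eqE.
Qed.

Lemma card_adm_coef_ge i : (2 * K <= #|adm_coef i|)%N.
Proof.
have [/card_adm_coef0 ->|/card_adm_coef_full ->] := eqVneq (i : nat) 0%N; lia.
Qed.

Lemma card_adm : #|adm| = (\prod_i #|adm_coef i|)%N.
Proof. by rewrite cardsE card_family_prod. Qed.

(** Two members of [E] which agree outside [S] have a difference that vanishes on
    [zs] and is supported on [S]; each coordinate in [S] has at least 2K values. *)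
Lemma card_vanishing_le (C : numClosedFieldType) (zs : seq C) (S : seq nat)
    (E : {set {ffun 'I_d -> T}}) :
  uniq S -> all (fun i => i < d)%N S -> rigid (2 * K) S zs -> {subset E <= adm} ->
  (forall c, c \in E -> {in zs, forall z, root (map_poly intr (ffpoly c)) z}) ->
  (#|E| * (2 * K) ^ size S <= #|adm|)%N.
Proof.
move=> uS Sd rS EA Ez.
pose S' := [set i : 'I_d | (i : nat) \in S].
have szS : size S = #|S'|.
  rewrite cardsE cardE -(size_map val) ; apply/perm_size/uniq_perm => //.
    by rewrite map_inj_uniq ?enum_uniq //; exact: val_inj.
  move=> i; apply/idP/mapP => [iS|[j]].
    by exists (Ordinal (allP Sd i iS)); rewrite // mem_enum.
  by rewrite mem_enum => jS ->.
apply: (@leq_trans (#|E| * \prod_(i in S') #|adm_coef i|)).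
  rewrite leq_mul2l szS -prod_nat_const; apply/orP; right.
  by apply: leq_prod => i _; exact: card_adm_coef_ge.
rewrite card_adm; apply: card_determined_off; first by move=> c /EA; rewrite inE.
move=> c c' cE c'E off; apply/ffunP => i.
have E0 : ffpoly c - ffpoly c' = 0.
  apply: rS => [j|j jS|z zz].
  - rewrite ffpolyB coef_rVpoly; case: insubP => [j' _ _|_]; last by rewrite normr0.
    by rewrite mxE norm_centreB_le.
  - rewrite ffpolyB coef_rVpoly; case: insubP => [j' _ jE|//].
    by rewrite mxE off ?subrr // inE jE.
  - by rewrite rmorphB /= rootE hornerD hornerN (rootP (Ez c cE z zz)) (rootP (Ez c' c'E z zz)) subrr.
have := congr1 (fun p : {poly int} => p`_i) E0; rewrite coefB !coef_ffpoly coef0.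
by rewrite /centre => /eqP; rewrite subr_eq0 => /eqP/addIr[] H; exact: val_inj.
Qed.

Lemma sum_sq_ffpoly c : \sum_(i < size (ffpoly c)) `|(ffpoly c)`_i| ^+ 2 <= (1 + d * K ^ 2)%:Z.
Proof.
rewrite size_ffpoly big_ord_recr /= addrC.
have -> : (ffpoly c)`_d = 1.
  by have := ffpoly_monic c; rewrite monicE lead_coefE size_ffpoly => /eqP.
rewrite normr1 expr1n PoszD lerD2l PoszM.
have -> : d%:Z * (K ^ 2)%:Z = \sum_(i < d) (K ^ 2)%:Z.
  by rewrite sumr_const card_ord -mulr_natl natz.
apply: ler_sum => i _; rewrite coef_ffpoly -[(K ^ 2)%:Z]natz natrX natz.
by apply: lerXn2r; rewrite ?nnegrE // norm_centre_le.
Qed.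

End Box.

Lemma card_cover_le (T I : finType) (E : {set T}) (F : I -> {set T}) :
  (forall x, x \in E -> exists i, x \in F i) -> (#|E| <= \sum_i #|F i|)%N.
Proof.
move=> H; apply: (@leq_trans #|\bigcup_i F i|).
  apply: subset_leq_card; apply/fintype.subsetP => x /H[i xi].
  by apply/bigcupP; exists i.
elim/big_ind2: _ => // [|A m B n Am Bn]; first by rewrite cards0.
by apply: leq_trans (leq_card_setU _ _) _; exact: leq_add.
Qed.

(** * Counting polynomials with a root at a given level *)

Section Levels.
Variable C : numClosedFieldType.
Variables (d K : nat).
Hypothesis K0 : (0 < K)%N.
Local Notation T := 'I_(K.*2.+1).
Local Notation toC := (map_poly (intr : int -> C)).
Implicit Types (c : {ffun 'I_d -> T}) (zs : seq C) (E : {set {ffun 'I_d -> T}}).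

(** The number [u] of Mahler measure doublings, in the sense of [rigid_exists], after
    which Landau's inequality excludes that a difference of two members of the box
    vanishes. *)
Definition at_level (n u : nat) zs :=
  [/\ galois_set zs, size zs = n, (4 * d * K ^ 2)%:R < mahler zs ^+ (2 * 2 ^ u) &
      mahler zs ^+ (2 ^ u) <= (4 * d * K ^ 2)%:R].

Lemma mahler_pow_le (n u b e : nat) zs : (4 * d * K ^ 2 <= 2 ^ b)%N ->
  (2 * n * b <= e * 2 ^ u)%N -> at_level n u zs -> mahler zs ^+ (2 * n) <= 2 ^+ e.
Proof.
move=> Bb be [_ _ _ Mu]; have M0 := le_trans ler01 (mahler_ge1 zs).
have u0 : (0 < 2 ^ u)%N by rewrite expn_gt0.
rewrite -(ler_pXn2r u0) ?nnegrE ?exprn_ge0 ?ler0n //.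
rewrite -!exprM (mulnC (2 * n)%N) exprM.
apply: (@le_trans _ _ ((2 ^+ b) ^+ (2 * n))).
  rewrite lerXn2r ?nnegrE ?exprn_ge0 ?ler0n //; apply: le_trans Mu _.
  by rewrite -natrX ler_nat.
by rewrite -exprM ler_weXn2l ?ler1n // mulnC.
Qed.

(** Members of [E] whose root sets have the same power sums share their root set, and
    then rigidity applies.  The number of possible vectors of power sums is the factor
    on the right. *)
Lemma card_level_le (n u h L' e b : nat) E :
  (n <= 2 ^ h)%N -> (2 ^ (u + h) * L' <= d)%N ->
  (4 * d * K ^ 2 <= 2 ^ b)%N -> (2 * n * b <= e * 2 ^ u)%N -> {subset E <= adm d K} ->
  (forall c, c \in E -> exists zs : seq C,
      at_level n u zs /\ {in zs, forall z, root (toC (ffpoly c)) z}) ->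
  (#|E| * (2 * K) ^ (2 ^ h * L') <= (2 * (n * 2 ^ e)).+1 ^ (2 * n) * #|adm d K|)%N.
Proof.
move=> nh hd Bb be EA HE.
set Y := (n * 2 ^ e)%N.
(* The power sums lie in [-Y, Y], so that t k - Y encodes an arbitrary value. *)
pose sums (t : {ffun 'I_(2 * n) -> 'I_(2 * Y).+1}) zs :=
  forall k : 'I_(2 * n), \sum_(z <- zs) z ^+ k = ((t k : nat)%:Z - Y%:Z)%:~R.
pose F (t : {ffun 'I_(2 * n) -> 'I_(2 * Y).+1}) := [set c in E |
  `[< exists zs : seq C, [/\ at_level n u zs, {in zs, forall z, root (toC (ffpoly c)) z}
        & sums t zs] >]].
have FE t : (#|F t| * (2 * K) ^ (2 ^ h * L') <= #|adm d K|)%N.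
  have [->|[c0]] := set_0Vmem (F t); first by rewrite cards0.
  rewrite inE => /andP[c0E /asboolP[zs0 [lev0 _ sum0]]].
  have [[cj0 _] sz0 big0 _] := lev0.
  have [||S [uS aS sS rS]] := @rigid_exists C (u + h) u L' (2 * K) zs0 cj0.
  - by rewrite sz0 expnD mulnC leq_mul2l nh orbT.
  - apply: le_lt_trans big0; rewrite ler_nat expnMn.
    by rewrite (_ : (4 * d * K ^ 2 = d * (2 ^ 2 * K ^ 2))%N) ?leq_mul2r ?hd ?orbT //; lia.
  have -> : (2 ^ h * L' = size S)%N by rewrite sS addKn.
  apply: (card_vanishing_le uS _ rS).
  - by apply: sub_all aS => i /leq_trans; apply.
  - by move=> c; rewrite inE => /andP[/EA].
  - move=> c; rewrite inE => /andP[_ /asboolP[zs [lev rc sumt]]] z zz0.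
    apply: rc; have [[[uz _ _ _ _] _] sz _ _] := lev; have [uz0 _ _ _ _] := cj0.
    rewrite (@power_sums_inj C zs zs0) ?sz ?sz0 // => k kn.
    by rewrite (sumt (Ordinal kn)) (sum0 (Ordinal kn)).
have cov c : c \in E -> exists t, c \in F t.
  move=> cE; have [zs [lev rc]] := HE c cE; have [gz sz _ _] := lev.
  (* The power sums are integers, bounded by means of the level. *)
  have psum (k : 'I_(2 * n)) : exists v : 'I_(2 * Y).+1,
      \sum_(z <- zs) z ^+ k = ((v : nat)%:Z - Y%:Z)%:~R.
    have [m mE] := power_sum_int k gz.
    have : `|(m%:~R : C)| <= Y%:R.
      rewrite -mE; apply: le_trans (norm_power_sum_le zs (ltnW (ltn_ord k))) _.
      by rewrite sz /Y natrM natrX ler_wpM2l ?ler0n // (mahler_pow_le Bb be lev).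
    rewrite -intr_norm pmulrn ler_int => mY.
    have vY : (absz (m + Y%:Z)%R < (2 * Y).+1)%N by lia.
    exists (Ordinal vY); rewrite mE; congr _%:~R; rewrite /=; lia.
  pose t := [ffun k => projT1 (cid (psum k))].
  exists t; rewrite inE cE /=; apply/asboolP; exists zs; split=> // k.
  by rewrite ffunE; case: cid.
have H : (#|E| * (2 * K) ^ (2 ^ h * L') <= (\sum_t #|F t|) * (2 * K) ^ (2 ^ h * L'))%N.
  by rewrite leq_mul2r card_cover_le ?orbT.
apply: leq_trans H _; rewrite big_distrl /=.
apply: (@leq_trans (\sum_(t : {ffun 'I_(2 * n) -> 'I_(2 * Y).+1}) #|adm d K|)).
  by apply: leq_sum => t _; exact: FE.
by rewrite sum_nat_const card_ffun !card_ord.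
Qed.

End Levels.

(** * Roots that are not roots of unity *)

Section NonCyclotomic.
Variable C : numClosedFieldType.
Variables (d K : nat).
Hypotheses (K0 : (0 < K)%N) (d0 : (0 < d)%N).
Local Notation T := 'I_(K.*2.+1).
Local Notation toC := (map_poly (intr : int -> C)).
Implicit Types (c : {ffun 'I_d -> T}) (zs : seq C) (E : {set {ffun 'I_d -> T}}).

Lemma mahler_ffpoly_le c zs : uniq zs -> {in zs, forall z, root (toC (ffpoly c)) z} ->
  mahler zs ^+ 2 <= (4 * d * K ^ 2)%:R.
Proof.
move=> uz rz; apply: le_trans (landau uz (monic_neq0 (ffpoly_monic c)) rz) _.
rewrite -rmorph_sum /= pmulrn ler_int; apply: le_trans (sum_sq_ffpoly c) _.
rewrite lez_nat; have : (0 < d * K ^ 2)%N by rewrite muln_gt0 d0 expn_gt0 K0.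
lia.
Qed.

(** Since f itself vanishes on [zs], Landau's inequality shows that the least exponent
    which works is positive; the preceding exponent fails. *)
Lemma level_exists (n X b U : nat) c zs : galois_set zs -> size zs = n ->
  {in zs, forall z, root (toC (ffpoly c)) z} ->
  2 <= mahler zs ^+ (4 * X) -> (4 * d * K ^ 2 < 2 ^ b)%N -> (4 * X * b <= 2 ^ U.+1)%N ->
  exists u : 'I_U.+1, at_level d K n u zs.
Proof.
move=> gz sz rz M2 Bb XU; have M1 := mahler_ge1 zs; have M0 := le_trans ler01 M1.
pose P u := (4 * d * K ^ 2)%:R < mahler zs ^+ (2 * 2 ^ u).
have PU : P U.
  apply: (@lt_le_trans _ _ (2 ^+ b)); first by rewrite -natrX ltr_nat.
  apply: (@le_trans _ _ ((mahler zs ^+ (4 * X)) ^+ b)).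
    by rewrite lerXn2r ?nnegrE ?exprn_ge0 ?ler0n.
  by rewrite -exprM -expnS ler_weXn2l.
have exP : exists u, P u by exists U.
have [u Pu minu] := ex_minnP exP.
have uU : (u < U.+1)%N by rewrite ltnS minu.
exists (Ordinal uU); split=> //=.
case: u {uU} Pu minu => [|v] Pv minv.
  have [[uz _ _ _ _] _] := gz.
  by have := le_lt_trans (mahler_ffpoly_le uz rz) Pv; rewrite ltxx.
rewrite expnS real_leNgt ?realn ?ger0_real ?exprn_ge0 //.
by apply/negP => /minv; rewrite ltnn.
Qed.

(** [D] is the factor gained at each level over the count of the root sets. *)
Lemma card_noncyclotomic_le (n X b U D : nat) E : {subset E <= adm d K} ->
  (4 * d * K ^ 2 < 2 ^ b)%N -> (4 * X * b <= 2 ^ U.+1)%N ->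
  (forall c, c \in E -> exists zs : seq C,
     [/\ galois_set zs, size zs = n, 2 <= mahler zs ^+ (4 * X)
       & {in zs, forall z, root (toC (ffpoly c)) z}]) ->
  (forall u, (u <= U)%N -> exists h L' e, [/\ (n <= 2 ^ h)%N, (2 ^ (u + h) * L' <= d)%N,
      (2 * n * b <= e * 2 ^ u)%N & ((2 * (n * 2 ^ e)).+1 ^ (2 * n) * D <= 2 ^ (2 ^ h * L'))%N]) ->
  (#|E| * D <= U.+1 * #|adm d K|)%N.
Proof.
move=> EA Bb XU HE num.
pose F (u : 'I_U.+1) := [set c in E | `[< exists zs : seq C,
   at_level d K n u zs /\ {in zs, forall z, root (toC (ffpoly c)) z} >]].
have cov c : c \in E -> exists u, c \in F u.
  move=> cE; have [zs [gz sz M2 rz]] := HE c cE.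
  have [u lev] := level_exists gz sz rz M2 Bb XU.
  by exists u; rewrite inE cE; apply/asboolP; exists zs.
apply: (@leq_trans ((\sum_u #|F u|) * D)).
  by rewrite leq_mul2r card_cover_le ?orbT.
have -> : (U.+1 * #|adm d K| = \sum_(u < U.+1) #|adm d K|)%N.
  by rewrite sum_nat_const card_ord.
rewrite big_distrl /=; apply: leq_sum => u _.
have [h [L' [e [nh hd be numu]]]] := num u (ltn_ord u : (u <= U)%N).
have FA : {subset F u <= adm d K} by move=> c; rewrite inE => /andP[/EA].
have H : (#|F u| * (2 * K) ^ (2 ^ h * L')
    <= (2 * (n * 2 ^ e)).+1 ^ (2 * n) * #|adm d K|)%N.
  apply: (card_level_le K0 nh hd (ltnW Bb) be FA) => c.
  by rewrite inE => /andP[_ /asboolP H]; exact: H.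
move: numu H; set G := ((2 * (n * 2 ^ e)).+1 ^ (2 * n))%N; set P := (2 ^ h * L')%N => numu H.
have G0 : (0 < G)%N by rewrite expn_gt0.
rewrite -(leq_pmul2l G0); apply: leq_trans H.
rewrite mulnCA leq_mul2l; apply/orP; right; apply: leq_trans numu _.
case: (P) => [|p]; first by rewrite !expn0.
by rewrite leq_exp2r // leq_pmulr.
Qed.
End NonCyclotomic.

(** * Roots of unity *)

Section Totient.
Local Open Scope nat_scope.

(** p^e <= phi(p^e)^2 for every prime power except 2, where a factor 2 is lost. *)
Lemma totient_sq_ge r : (0 < r -> r <= 2 * totient r ^ 2)%N.
Proof.
move=> r0; rewrite totientE // [leqLHS](prod_prime_decomp r0) prime_decompE big_map /=.
apply: (@leq_trans (\prod_(p <- primes r) ((if p == 2 then 2 else 1) * (p.-1 * p ^ (logn p r).-1) ^ 2))).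
  rewrite big_seq [leqRHS]big_seq; apply: leq_prod => p pr.
  have l0 : (0 < logn p r)%N by rewrite logn_gt0.
  have := pr; rewrite mem_primes => /and3P[pp _ _].
  case: (logn p r) l0 => // e _; rewrite /= expnS expnMn.
  have [->|p2] := eqVneq p 2.
    rewrite exp1n mul1n -expnM leq_mul2l /= leq_exp2l //; lia.
  rewrite mul1n; have p3 : (2 < p)%N by have := prime_gt1 pp; lia.
  apply: leq_mul; first by case: (p) p3 => // k; rewrite /= => k2; nia.
  by rewrite -expnM leq_exp2l ?prime_gt1 //; lia.
rewrite big_split /= -[X in (_ * X <= _)%N]/(\prod_(p <- primes r) _) .
have -> : (\prod_(p <- primes r) (p.-1 * p ^ (logn p r).-1) ^ 2 =
   (\prod_(p <- primes r) (p.-1 * p ^ (logn p r).-1)) ^ 2)%N.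
  by elim/big_rec2: _ => [|p x y _ ->]; rewrite ?expnMn.
rewrite leq_mul2r; apply/orP; right.
have [p2|p2] := boolP (2 \in primes r).
  rewrite (bigD1_seq 2) ?primes_uniq //= big1 ?muln1 // => p; by case: eqP.
rewrite big_seq big1 // => p pr; case: eqP => // E; by rewrite E (negbTE p2) in pr.
Qed.

End Totient.

Section Classes.
Variables (R : realType) (d K : nat).
Hypotheses (K0 : (0 < K)%N).
Local Notation T := 'I_(K.*2.+1).
Implicit Types (c : {ffun 'I_d -> T}) (E : {set {ffun 'I_d -> T}}) (S : {set 'I_d}).

Definition lo_weight S : R := 2 / Num.sqrt #|S|.+1%:R.

Lemma lo_weight_ge0 S : 0 <= lo_weight S.
Proof. by rewrite divr_ge0 ?sqrtr_ge0. Qed.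

(** The bound for one class of coordinates, applied to [S] and then, after forgetting
    [S], to [S']. *)
Lemma card_two_classes_le E S S' : {subset E <= adm d K} -> [disjoint S & S'] ->
  (forall i : 'I_d, i \in S :|: S' -> (i : nat) != 0%N) ->
  (forall c c', c \in E -> c' \in E -> (forall i, i \notin S :|: S' -> c i = c' i) ->
    (\sum_(i in S) c i = \sum_(i in S) c' i)%N /\ (\sum_(i in S') c i = \sum_(i in S') c' i)%N) ->
  #|E|%:R <= #|adm d K|%:R * lo_weight S * lo_weight S' :> R.
Proof.
move=> EA dis n0 H; pose e : {ffun 'I_d -> T} := [ffun=> ord0].
have S'S i : i \in S' -> i \notin S by move=> iS; rewrite (disjointFl dis).
pose E1 := [set overwrite S e c | c in E].
pose E2 := [set overwrite S' e c | c in E1].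
have H1 : #|E|%:R <= #|E1|%:R * (2 * (K.*2.+1)%:R ^+ #|S| / Num.sqrt #|S|.+1%:R) :> R.
  apply: (card_sum_determined R K0) => c c' cE c'E off; apply: (H c c' cE c'E _).1 => i.
  by rewrite inE negb_or => /andP[iS _]; exact: off.
have H2 : #|E1|%:R <= #|E2|%:R * (2 * (K.*2.+1)%:R ^+ #|S'| / Num.sqrt #|S'|.+1%:R) :> R.
  apply: (card_sum_determined R K0) => _ _ /imsetP[c cE ->] /imsetP[c' c'E ->] off.
  have -> : (\sum_(i in S') overwrite S e c i = \sum_(i in S') c i)%N.
    by apply: eq_bigr => i iS'; rewrite ffunE (negbTE (S'S i iS')).
  have -> : (\sum_(i in S') overwrite S e c' i = \sum_(i in S') c' i)%N.
    by apply: eq_bigr => i iS'; rewrite ffunE (negbTE (S'S i iS')).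
  apply: (H c c' cE c'E _).2 => i; rewrite inE negb_or => /andP[iS iS'].
  by have := off i iS'; rewrite !ffunE (negbTE iS).
have H3 : (#|E2| <= \prod_(i | i \notin S :|: S') #|@adm_coef d K i|)%N.
  have -> : E2 = [set overwrite (S :|: S') e c | c in E].
    rewrite /E2 /E1 -imset_comp; apply: eq_imset => c; apply/ffunP => i.
    by rewrite !ffunE inE orbC; case: (i \in S').
  by apply: card_overwrite_le => c /EA; rewrite inE.
have cA : (#|adm d K| = (\prod_(i | i \notin S :|: S') #|@adm_coef d K i|)
     * (K.*2.+1 ^ #|S| * K.*2.+1 ^ #|S'|))%N.
  rewrite card_adm (bigID (mem (S :|: S'))) /= mulnC; congr muln.
  rewrite (eq_bigr (fun=> K.*2.+1)); last first.
    by move=> i iS; rewrite card_adm_coef_full ?n0 // mul2n.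
  by rewrite prod_nat_const -expnD cardsU disjoint_setI0 // cards0 subn0.
set P := (\prod_(i | _) _)%N in H3 cA.
apply: le_trans H1 _.
have w0 : 0 <= 2 * (K.*2.+1)%:R ^+ #|S| / Num.sqrt #|S|.+1%:R :> R.
  by rewrite divr_ge0 ?sqrtr_ge0 // mulr_ge0 ?exprn_ge0.
have w0' : 0 <= 2 * (K.*2.+1)%:R ^+ #|S'| / Num.sqrt #|S'|.+1%:R :> R.
  by rewrite divr_ge0 ?sqrtr_ge0 // mulr_ge0 ?exprn_ge0.
apply: le_trans (ler_wpM2r w0 H2) _.
have H3' : #|E2|%:R <= P%:R :> R by rewrite ler_nat.
apply: le_trans (ler_wpM2r w0 (ler_wpM2r w0' H3')) _.
rewrite cA !natrM !natrX /lo_weight le_eqVlt; apply/orP; left; apply/eqP; ring.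
Qed.

Lemma lo_weight0 : lo_weight finset.set0 = 2.
Proof. by rewrite /lo_weight cards0 sqrtr1 divr1. Qed.

(** Zero is excluded because the constant coefficient has a different range. *)
Definition residue r a : {set 'I_d} := [set i : 'I_d | (0 < i)%N && (i %% r == a)%N].

Lemma card_residue_ge r a : (a < r)%N -> (d %/ r <= #|residue r a|.+1)%N.
Proof.
move=> ar; have r0 : (0 < r)%N by apply: leq_ltn_trans ar.
suff : ((d %/ r).-1 <= #|residue r a|)%N by case: (d %/ r)%N.
have -> : #|residue r a| = size [seq val i | i <- enum (residue r a)] by rewrite size_map cardE.
have -> : (d %/ r).-1 = size [seq j.+1 * r + a | j <- iota 0 (d %/ r).-1]%N.
  by rewrite size_map size_iota.
apply: uniq_leq_size.
  rewrite map_inj_uniq ?iota_uniq // => i j /addIn /eqP.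
  by rewrite eqn_mul2r (gtn_eqF r0) /= eqSS => /eqP.
move=> x /mapP[j jd ->]; move: jd; rewrite mem_iota add0n /= => jd.
have lt : (j.+1 * r + a < d)%N.
  apply: leq_trans (leq_trunc_div d r).
  have : (j.+2 <= d %/ r)%N by move: jd; lia.
  by rewrite -(leq_pmul2r r0); lia.
apply/mapP; exists (Ordinal lt) => //.
by rewrite mem_enum inE /= modnMDl modn_small // eqxx andbT; lia.
Qed.

Lemma lo_weight_residue r a : (a < r)%N -> (r <= d)%N ->
  lo_weight (residue r a) <= 2 * Num.sqrt (2 * r%:R / d%:R).
Proof.
move=> ar rd; have r0 : (0 < r)%N by apply: leq_ltn_trans ar.
have d0 : 0 < d%:R :> R by rewrite ltr0n (leq_trans r0).
rewrite /lo_weight ler_wpM2l // -sqrtrV // ler_wsqrtr //.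
rewrite ler_pdivlMr // ler_pdivrMl ?ltr0n // -!natrM ler_nat.
have := card_residue_ge ar; have : (0 < d %/ r)%N by rewrite divn_gt0.
have := ltn_ceil d r0.
set q := (d %/ r)%N; set N := #|_|; nia.
Qed.

Section Root.
Variables (C : numClosedFieldType) (zeta : C) (r : nat).
Hypotheses (r0 : (0 < r)%N) (rd : (r <= d)%N) (zr : zeta ^+ r = 1).
Local Notation toC := (map_poly (intr : int -> C)).

Lemma horner_ffpoly c : (toC (ffpoly c)).[zeta] =
  zeta ^+ d + \sum_(i < d) (centre (c i))%:~R * zeta ^+ i.
Proof.
rewrite /ffpoly rmorphD /= map_polyXn hornerD hornerXn; congr (_ + _).
rewrite (@horner_coef_wide _ d); last first.
  by rewrite size_map_inj_poly ?size_poly //; exact: intr_inj.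
by apply: eq_bigr => i _; rewrite coef_map /= coef_rVpoly_ord mxE.
Qed.

Lemma vanishing_diff c c' : root (toC (ffpoly c)) zeta -> root (toC (ffpoly c')) zeta ->
  \sum_(i < d) ((c i)%:R - (c' i)%:R) * zeta ^+ i = 0.
Proof.
move=> /rootP h /rootP h'.
have : (toC (ffpoly c)).[zeta] - (toC (ffpoly c')).[zeta] = 0 by rewrite h h' subrr.
rewrite !horner_ffpoly opprD addrACA subrr add0r -sumrB => E; rewrite -[RHS]E.
by apply: eq_bigr => i _; rewrite -mulrBl /centre !rmorphB /= opprB addrA subrK.
Qed.

Lemma expr_residue a i : i \in residue r a -> zeta ^+ i = zeta ^+ a.
Proof.
rewrite inE => /andP[_ /eqP <-].
by rewrite {1}(divn_eq i r) exprD mulnC exprM zr expr1n mul1r.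
Qed.

Lemma sum_residue a c c' : \sum_(i in residue r a) ((c i)%:R - (c' i)%:R) * zeta ^+ i
  = ((\sum_(i in residue r a) c i)%N%:R - (\sum_(i in residue r a) c' i)%N%:R) * zeta ^+ a.
Proof.
rewrite !natr_sum -sumrB mulr_suml; apply: eq_bigr => i ia.
by rewrite (expr_residue ia).
Qed.

Lemma card_root_of_unity_le E : {subset E <= adm d K} ->
  (forall c, c \in E -> root (toC (ffpoly c)) zeta) ->
  #|E|%:R <= #|adm d K|%:R * (4 * Num.sqrt (2 * r%:R / d%:R)) :> R.
Proof.
move=> EA Er.
have H : #|E|%:R <= #|adm d K|%:R * lo_weight (residue r 0) * lo_weight finset.set0 :> R.
  apply: card_two_classes_le => //.
  - by rewrite -setI_eq0 finset.setI0 eqxx.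
  - by move=> i; rewrite !inE orbF -lt0n => /andP[].
  move=> c c' cE c'E off; split; last by rewrite !big_set0.
  have := vanishing_diff (Er c cE) (Er c' c'E).
  rewrite (bigID (mem (residue r 0))) /= [X in _ + X]big1 ?addr0; last first.
    by move=> i i0; rewrite off ?subrr ?mul0r // inE negb_or i0 inE.
  rewrite sum_residue expr0 mulr1 => /eqP; rewrite subr_eq0 eqr_nat => /eqP; exact.
apply: le_trans H _; rewrite lo_weight0 -mulrA ler_wpM2l //.
by have := lo_weight_residue r0 rd; lra.
Qed.

(** If 1 and zeta are linearly independent over Q, then f(zeta) = 0 determines two
    sums of coefficients instead of one. *)
Lemma card_root_of_unity2_le zs E : galois_set zs -> zeta \in zs -> (1 < size zs)%N ->
  (1 < r)%N -> {subset E <= adm d K} ->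
  (forall c, c \in E -> root (toC (ffpoly c)) zeta) ->
  #|E|%:R <= #|adm d K|%:R * (8 * r%:R / d%:R) :> R.
Proof.
move=> [[uz _ _ _ cj] _] zz sz r1 EA Er.
have indep (a b : int) : a%:~R + b%:~R * zeta = 0 :> C -> a = 0 /\ b = 0.
  move=> ab; pose h : {poly int} := a%:P + b *: 'X.
  have hz : root (toC h) zeta.
    rewrite rmorphD /= map_polyC map_polyZ map_polyX rootE.
    by rewrite hornerD hornerC hornerZ hornerX ab.
  have h0 : h = 0.
    apply/eqP/negPn/negP => hn.
    have hn' : toC h != 0 by rewrite map_poly_eq0_id0 // intr_eq0 lead_coef_eq0.
    have all_r : all (root (toC h)) zs by apply/allP => z zz'; exact: cj zz zz' hz.
    have := max_poly_roots hn' all_r uz.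
    rewrite size_map_inj_poly //; last exact: intr_inj.
    rewrite ltnNge => /negP; apply; apply: leq_trans sz.
    rewrite (leq_trans (size_polyD _ _)) // geq_max size_polyC.
    rewrite (leq_trans (size_scale_leq _ _)) ?size_polyX // andbT.
    by case: (a != 0).
  have := congr1 (fun p : {poly int} => p`_0) h0; have := congr1 (fun p : {poly int} => p`_1) h0.
  move=> /[swap]; cbv beta; rewrite !coef0 !coefD !coefC !coefZ !coefX /= mulr0 mulr1.
  by rewrite addr0 add0r.
have H : #|E|%:R <= #|adm d K|%:R * lo_weight (residue r 0) * lo_weight (residue r 1) :> R.
  have dis : [disjoint residue r 0 & residue r 1].
    rewrite -setI_eq0; apply/eqP/setP => i; rewrite !inE.
    by case: eqP => [->|_]; rewrite ?andbF.
  apply: card_two_classes_le => //.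
  - by move=> i; rewrite !inE -lt0n => /orP[]/andP[].
  move=> c c' cE c'E off.
  have := vanishing_diff (Er c cE) (Er c' c'E).
  rewrite (bigID (mem (residue r 0 :|: residue r 1))) /= [X in _ + X]big1 ?addr0; last first.
    by move=> i i0; rewrite off ?subrr ?mul0r.
  rewrite (eq_bigl [predU residue r 0 & residue r 1]); last by move=> i; rewrite !inE.
  rewrite bigU //= !sum_residue expr0 expr1 mulr1.
  set a := (\sum_(i in residue r 0) c i)%N; set a' := (\sum_(i in residue r 0) c' i)%N.
  set b := (\sum_(i in residue r 1) c i)%N; set b' := (\sum_(i in residue r 1) c' i)%N.
  move=> E0; have [|A B] := indep (a%:Z - a'%:Z) (b%:Z - b'%:Z); first by rewrite !rmorphB.
  by split; [move: A|move: B] => /eqP; rewrite subr_eq0 => /eqP[].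
apply: le_trans H _; rewrite -mulrA ler_wpM2l //.
apply: (@le_trans _ _ ((2 * Num.sqrt (2 * r%:R / d%:R)) ^+ 2)).
  rewrite expr2; apply: ler_pM; rewrite ?lo_weight_ge0 ?lo_weight_residue //.
by rewrite exprMn sqr_sqrtr ?divr_ge0 ?mulr_ge0 //; lra.
Qed.
End Root.

End Classes.

(** The lowest coefficients are determined by the others, by interpolation. *)
Lemma card_roots_le (C : numClosedFieldType) (d K : nat) (zs : seq C)
    (E : {set {ffun 'I_d -> 'I_(K.*2.+1)}}) : uniq zs -> (size zs <= d)%N ->
  {subset E <= adm d K} ->
  (forall c, c \in E -> {in zs, forall z, root (map_poly intr (ffpoly c)) z}) ->
  (#|E| * (2 * K) ^ size zs <= #|adm d K|)%N.
Proof.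
move=> uz szd EA Er; rewrite -[X in (_ * _ ^ X)%N](size_iota 0).
apply: (card_vanishing_le _ _ _ EA Er); first exact: iota_uniq.
  by apply/allP => i; rewrite mem_iota add0n /= => /leq_trans; apply.
move=> v _ vS rv; apply/eqP/negPn/negP => v0.
have v0' : map_poly (intr : int -> C) v != 0 by rewrite map_poly_eq0_id0 // intr_eq0 lead_coef_eq0.
have all_r : all (root (map_poly intr v)) zs by apply/allP.
have := max_poly_roots v0' all_r uz; rewrite size_map_inj_poly //; last exact: intr_inj.
rewrite ltnNge => /negP; apply; apply/leq_sizeP => j jn; apply: vS.
by rewrite mem_iota add0n /= -leqNgt.
Qed.

(** * Numerical estimates *)

Section Growth.
Local Open Scope nat_scope.

(** With q the quotient of l by k+1, 2^l >= (2^q)^(k+1) >= (q+1)^(k+1), and l < (q+1)(k+1). *)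
Lemma exp_beats_poly (c k : nat) : exists L : nat, forall l, (L <= l -> c * l ^ k <= 2 ^ l)%N.
Proof.
exists (c * k.+1 ^ k.+1)%N => l cl.
have kk : (0 < k.+1 ^ k.+1)%N by rewrite expn_gt0.
rewrite -(leq_pmul2r kk); apply: (@leq_trans (l ^ k.+1)).
  by rewrite (expnS l) mulnAC leq_mul2r cl orbT.
set q := (l %/ k.+1)%N.
apply: (@leq_trans ((q.+1 * k.+1) ^ k.+1)); first by rewrite leq_exp2r // ltnW // ltn_ceil.
rewrite expnMn leq_mul2r; apply/orP; right.
apply: (@leq_trans ((2 ^ q) ^ k.+1)); first by rewrite leq_exp2r // ltn_expl.
by rewrite -expnM leq_exp2l // leq_trunc_div.
Qed.

End Growth.

Section Numeric.
Local Open Scope nat_scope.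
Variables (a B l n d : nat).
Hypotheses (a1 : 1 < a) (n0 : 0 < n) (ld : 2 ^ l <= d) (dl : d < 2 ^ l.+1)
  (nd : n ^ 2 * l ^ 4 <= 16 * d) (lbig : 24 * 1024 * a * (12 + 2 * B) <= l).

Lemma l_ge : 12 * 1024 * a <= l /\ (96 * 96) <= l.
Proof.
clear - a1 lbig.
have : 24 * 1024 * a * 12 <= 24 * 1024 * a * (12 + 2 * B) by rewrite leq_mul2l leq_addr orbT.
by move=> h; have h2 := leq_trans h lbig; split; lia.
Qed.

Lemma l_le_d : l < d.
Proof. clear - ld; exact: leq_trans (ltn_expl l (isT : 1 < 2)) ld. Qed.

Lemma l_gt0 : 0 < l. Proof. clear - a1 lbig; have [_ ?] := l_ge; lia. Qed.

Lemma n_le_d : 24 * l * n <= d.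
Proof.
clear - a1 ld nd lbig.
have [_ l9] := l_ge; have ld' := l_le_d.
rewrite -(@leq_exp2r _ _ 2) // -(@leq_pmul2r (l ^ 2)) ?expn_gt0 ?l_gt0 //.
have -> : (24 * l * n) ^ 2 * l ^ 2 = 576 * (n ^ 2 * l ^ 4).
  by rewrite !expnMn (_ : l ^ 4 = l ^ 2 * l ^ 2) -?expnD //; lia.
apply: (@leq_trans (576 * (16 * d))); first by rewrite leq_mul2l nd orbT.
have -> : 576 * (16 * d) = d * (96 * 96) by lia.
rewrite (_ : d ^ 2 * l ^ 2 = d * (d * l ^ 2)); last by rewrite mulnA mulnn.
by rewrite leq_mul2l; apply/orP; right; nia.
Qed.

Lemma numeric_primes : exists k, [/\ 0 < k, k * (5 * n).+1 <= 2 ^ k.-1 & 2 ^ k <= 24 * l * n].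
Proof.
have l0 := l_gt0; set q := l * (5 * n).+1.
have q1 : 1 < q by rewrite /q; have [_ ?] := l_ge; nia.
have H1 := up_logP q (isT : 1 < 2); have H2 := up_log_gtn (isT : 1 < 2) q1.
set t := up_log 2 q in H1 H2.
have t0 : 0 < t by rewrite /t up_log_gt0.
have Ht : 2 ^ t < 2 * q by rewrite -(prednK t0) expnS ltn_pmul2l.
have k24 : 2 ^ t.+1 <= 24 * l * n by rewrite expnS; move: Ht; rewrite /q; nia.
exists t.+1; split=> //=; apply: leq_trans H1; rewrite /q leq_mul2r; apply/orP; right.
rewrite -ltnS -(@ltn_exp2l 2) //; apply: leq_ltn_trans dl.
exact: leq_trans k24 n_le_d.
Qed.

(** A bound for the binary length of 4 d K^2 when K is at most d^(a-1). *)
Definition bits := 4 * a * l.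

Lemma numeric_bits K : 0 < K -> K <= d ^ (a - 1) -> 4 * d * K ^ 2 < 2 ^ bits.
Proof.
clear - a1 dl lbig; move=> K0 Kd.
have dK : d * K ^ 2 <= d ^ (2 * a - 1).
  have -> : 2 * a - 1 = (1 + (a - 1) * 2) by lia.
  by rewrite expnD expn1 leq_mul2l expnM leq_exp2r // Kd orbT.
have : d ^ (2 * a - 1) < 2 ^ (l.+1 * (2 * a - 1)).
  by rewrite expnM ltn_exp2r //; lia.
have : 4 * 2 ^ (l.+1 * (2 * a - 1)) <= 2 ^ bits.
  rewrite -(expnD 2 2) leq_exp2l // /bits; have [_ l9] := l_ge; nia.
move=> h1 h2; rewrite -mulnA; apply: leq_trans h1; rewrite ltn_pmul2l //.
exact: leq_ltn_trans dK h2.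
Qed.

Lemma numeric_levels k : 0 < k -> 2 ^ k <= 24 * l * n ->
  exists U, [/\ 4 * 2 ^ k * bits <= 2 ^ U.+1, U < 3 * l.+1 &
    forall u, u <= U -> 2 ^ u <= 384 * a * l ^ 2 * n].
Proof.
move=> k0 kl; set q := 4 * 2 ^ k * bits; have l0 := l_gt0.
have pk : 0 < 2 ^ k by rewrite expn_gt0.
have q1 : 1 < q by rewrite /q /bits; nia.
have H1 := up_logP q (isT : 1 < 2); have H2 := up_log_gtn (isT : 1 < 2) q1.
set t := up_log 2 q in H1 H2.
have t0 : 0 < t by rewrite /t up_log_gt0.
have bu : 2 ^ t.-1 <= 384 * a * l ^ 2 * n.
  apply: leq_trans (ltnW H2) _; rewrite /q /bits.
  apply: (@leq_trans (4 * (24 * l * n) * (4 * a * l))).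
    by rewrite leq_mul2r leq_mul2l kl !orbT.
  by rewrite -mulnn; nia.
exists t.-1; split; first by rewrite prednK.
  rewrite -(@ltn_exp2l 2) //; apply: leq_ltn_trans bu _.
  apply: (@leq_ltn_trans (d * (d * d))).
    have -> : 384 * a * l ^ 2 * n = (16 * a) * (l * (24 * l * n)) by rewrite -mulnn; lia.
    have [la _] := l_ge; have ld' := l_le_d.
    by apply: leq_mul; [lia|apply: leq_mul; [lia|exact: n_le_d]].
  have -> : d * (d * d) = d ^ 3 by rewrite !expnS expn0 muln1.
  by rewrite mulnC expnM ltn_exp2r.
by move=> u ut; apply: leq_trans bu; rewrite leq_exp2l.
Qed.

(** [h] is log2 n rounded up, so that u + h squarings suffice in [rigid_exists], and
    2^h L' is about d / 2^u.  The left-hand side has exponent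
    O(n^2 log d / 2^u + n log d), and 2^u is O(n (log d)^2). *)
Lemma numeric_level_bound u : 2 ^ u <= 384 * a * l ^ 2 * n ->
  exists h L' e, [/\ n <= 2 ^ h, 2 ^ (u + h) * L' <= d, 2 * n * bits <= e * 2 ^ u &
     (2 * (n * 2 ^ e)).+1 ^ (2 * n) * 2 ^ (B * l) <= 2 ^ (2 ^ h * L')].
Proof.
move=> ub; have l0 := l_gt0; have [la l9] := l_ge; have ld' := l_le_d.
set W := 2 ^ u in ub *; have W0 : 0 < W by rewrite expn_gt0.
(* Rounding log2 n up costs at most a factor 2. *)
have [h [nh hn]] : exists h, n <= 2 ^ h /\ 2 ^ h <= 2 * n.
  have [->|n1] := eqVneq n 1; first by exists 0.
  have n1' : 1 < n by lia.
  exists (up_log 2 n); split; first exact: up_logP.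
  have t0 : 0 < up_log 2 n by rewrite up_log_gt0.
  by rewrite -(prednK t0) expnS leq_mul2l ltnW // up_log_gtn.
have nl4 : n ^ 2 * l ^ 2 * l ^ 2 <= 16 * d by rewrite -mulnA -expnD.
have hd : 2 ^ (u + h) <= d.
  rewrite expnD -/W -(@leq_pmul2r (l ^ 2)) ?expn_gt0 ?l0 //.
  apply: (@leq_trans (384 * a * l ^ 2 * n * (2 * n) * l ^ 2)).
    by rewrite leq_mul2r leq_mul ?orbT.
  have -> : 384 * a * l ^ 2 * n * (2 * n) * l ^ 2 = 768 * a * (n ^ 2 * l ^ 2 * l ^ 2).
    by rewrite -mulnn; lia.
  apply: (@leq_trans (768 * a * (16 * d))); first by rewrite leq_mul2l nl4 orbT.
  have -> : 768 * a * (16 * d) = (12 * 1024 * a) * d by lia.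
  by rewrite mulnC leq_mul2l; apply/orP; right; apply: leq_trans la _; rewrite -mulnn; nia.
set L' := d %/ 2 ^ (u + h).
have p0 : 0 < 2 ^ (u + h) by rewrite expn_gt0.
have L1 : 0 < L' by rewrite divn_gt0.
have dL : d <= 2 * W * (2 ^ h * L').
  have := ltn_ceil d p0; rewrite -/L' expnD -/W.
  move: L1; set H := 2 ^ h; move=> L1 lt.
  apply: leq_trans (ltnW lt) _.
  have -> : 2 * W * (H * L') = (L' + L') * (W * H) by lia.
  by rewrite leq_mul2r; apply/orP; right; lia.
set e := ((2 * n * bits) %/ W).+1.
exists h, L', e; split=> //.
- by rewrite mulnC leq_trunc_div.
- exact: ltnW (ltn_ceil _ W0).
set P := 2 ^ h * L' in dL *.
have base : (2 * (n * 2 ^ e)).+1 <= 2 ^ (e + l + 3).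
  have n2 : n < 2 ^ l.+1.
    by apply: leq_ltn_trans dl; apply: leq_trans n_le_d; rewrite leq_pmull // muln_gt0.
  rewrite (_ : e + l + 3 = 2 + (l.+1 + e)); last by lia.
  have : n * 2 ^ e <= 2 ^ (l.+1 + e) by rewrite expnD leq_mul2r ltnW ?orbT.
  have : 0 < 2 ^ (l.+1 + e) by rewrite expn_gt0.
  rewrite (expnD 2 2); set y := 2 ^ (l.+1 + e); set x := n * _; lia.
apply: (@leq_trans (2 ^ ((e + l + 3) * (2 * n)) * 2 ^ (B * l))).
  by rewrite leq_mul2r (expnM 2 (e + l + 3)) leq_exp2r ?base ?orbT // muln_gt0 n0.
rewrite -expnD leq_exp2l //.
have W2 : 0 < 2 * W by rewrite muln_gt0.
rewrite -(leq_pmul2l W2); apply: leq_trans dL.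
have eW : e * W <= 2 * n * bits + W.
  by rewrite /e mulSn addnC leq_add2r leq_trunc_div.
(* The exponent is split into two terms, each at most d / 2 after multiplying by 2^(u+1). *)
have half1 : 2 * (4 * n * (2 * n * bits)) <= d.
  rewrite /bits -(@leq_pmul2r (l ^ 3)) ?expn_gt0 ?l0 //.
  have -> : 2 * (4 * n * (2 * n * (4 * a * l))) * l ^ 3 = 64 * a * (n ^ 2 * l ^ 2 * l ^ 2).
    by rewrite -!mulnn expnS -mulnn; lia.
  apply: (@leq_trans (64 * a * (16 * d))); first by rewrite leq_mul2l nl4 orbT.
  have -> : 64 * a * (16 * d) = d * (1024 * a) by lia.
  rewrite leq_mul2l; apply/orP; right; apply: (@leq_trans l); first by lia.
  by rewrite -{1}[l]expn1 leq_pexp2l.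
have half2 : 2 * (W * (4 * n * (l + 4) + 2 * (B * l))) <= d.
  apply: (@leq_trans (2 * ((384 * a * l ^ 2 * n) * (n * l * (12 + 2 * B))))).
    rewrite leq_mul2l leq_mul //.
    have : B * l <= n * (B * l) by rewrite leq_pmull.
    have : n * (l + 4) <= n * (3 * l) by rewrite leq_mul2l; apply/orP; right; lia.
    lia.
  rewrite -(@leq_pmul2r l) //.
  have -> : 2 * (384 * a * l ^ 2 * n * (n * l * (12 + 2 * B))) * l =
      768 * a * (12 + 2 * B) * (n ^ 2 * l ^ 2 * l ^ 2) by rewrite -!mulnn; lia.
  apply: (@leq_trans (768 * a * (12 + 2 * B) * (16 * d))); first by rewrite leq_mul2l nl4 orbT.
  have -> : 768 * a * (12 + 2 * B) * (16 * d) = d * (12 * 1024 * a * (12 + 2 * B)) by lia.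
  rewrite leq_mul2l; apply/orP; right; apply: leq_trans lbig.
  by rewrite leq_mul2r -!mulnA leq_mul2r orbT.
have -> : 2 * W * ((e + l + 3) * (2 * n) + B * l) =
   4 * n * (e * W) + W * (4 * n * (l + 3) + 2 * (B * l)) by lia.
have : 4 * n * (e * W) <= 4 * n * (2 * n * bits + W) by rewrite leq_mul2l eW orbT.
have -> : 4 * n * (2 * n * bits + W) = 4 * n * (2 * n * bits) + 4 * n * W by lia.
have E : W * (4 * n * (l + 4) + 2 * (B * l)) = W * (4 * n * (l + 3) + 2 * (B * l)) + 4 * n * W.
  by lia.
rewrite E in half2; clear E; move: half1 half2.
set x1 := 4 * n * (2 * n * bits); set x2 := W * (4 * n * (l + 3) + 2 * (B * l)).
set x3 := 4 * n * W; set x4 := 4 * n * (e * W); clear; lia.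
Qed.

End Numeric.

(** * Bad polynomials *)

Section BadSets.
Local Notation toC := (map_poly (intr : int -> algC)).
Variables (d K : nat).
Hypotheses (K0 : (0 < K)%N) (d0 : (0 < d)%N).
Local Notation T := 'I_(K.*2.+1).
Implicit Types (c : {ffun 'I_d -> T}) (x z : algC).

Definition bad m : {set {ffun 'I_d -> T}} := [set c in adm d K |
  `[< exists2 x : algC, root (toC (ffpoly c)) x & ((size (minCpoly x)).-1 <= m)%N >]].

Definition noncyc n : {set {ffun 'I_d -> T}} := [set c in adm d K |
  `[< exists zs : seq algC, [/\ galois_set zs, size zs = n,
        {in zs, forall z k, (0 < k)%N -> z ^+ k <> 1} &
        {in zs, forall z, root (toC (ffpoly c)) z}] >]].

Definition cyc r : {set {ffun 'I_d -> T}} := [set c in adm d K |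
  `[< exists2 z : algC, r.-primitive_root z & root (toC (ffpoly c)) z >]].

Lemma root_galois c x : c \in adm d K -> root (toC (ffpoly c)) x ->
  exists zs : seq algC, [/\ galois_set zs, x \in zs, size zs = (size (minCpoly x)).-1,
    minCpoly x = \prod_(z <- zs) ('X - z%:P) & {in zs, forall z, root (toC (ffpoly c)) z}].
Proof.
move=> cA rx.
have xI : x \in Aint.
  apply: root_monic_Aint rx _ _; first exact: monic_map (ffpoly_monic c).
  by apply/polyOverP => i; rewrite coef_map /= intr_int.
have x0 : x != 0.
  apply/eqP => x0; move: rx; rewrite x0 rootE horner_coef0 coef_map /= intr_eq0.
  have := coef_ffpoly c (Ordinal d0) => /= ->.
  move: cA; rewrite inE => /familyP/(_ (Ordinal d0)); rewrite !inE eqxx /= => cK.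
  by rewrite /centre subr_eq0 eqz_nat (negbTE cK).
have [zs [gz [xz zE]]] := galois_set_of_Aint xI x0.
exists zs; split=> //; first by rewrite zE size_prod_XsubC.
by move=> z zz; case: gz => [[_ _ _ _ cj] _]; exact: cj xz zz rx.
Qed.

(** Primitive r-th roots of unity are conjugate. *)
Lemma cyc_root r c z : c \in cyc r -> r.-primitive_root z -> root (toC (ffpoly c)) z.
Proof.
rewrite inE => /andP[cA /asboolP[y yr ry]] zr.
have [zs [_ _ _ zE rz]] := root_galois cA ry.
by apply: rz; rewrite -root_prod_XsubC -zE (minCpoly_cyclotomic yr) (root_cyclotomic yr).
Qed.

Lemma card_cyc_exp_le r : (totient r <= d)%N -> (#|cyc r| * (2 * K) ^ totient r <= #|adm d K|)%N.
Proof.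
move=> rd; have [->|[c cr]] := set_0Vmem (cyc r); first by rewrite cards0.
have := cr; rewrite inE => /andP[cA /asboolP[y yr ry]].
have [zs [[[uz _ _ _ _] _] _ sz zE rz]] := root_galois cA ry.
have -> : totient r = size zs by rewrite sz (minCpoly_cyclotomic yr) size_cyclotomic.
apply: (@card_roots_le algC) => //.
- by rewrite sz (minCpoly_cyclotomic yr) size_cyclotomic.
- by move=> c'; rewrite inE => /andP[].
- move=> c' c'r z zz; apply: (cyc_root c'r).
  by rewrite -(root_cyclotomic yr) -(minCpoly_cyclotomic yr) zE root_prod_XsubC.
Qed.

Lemma card_cyc1_le (R : realType) r : (r <= d)%N ->
  #|cyc r|%:R <= #|adm d K|%:R * (4 * Num.sqrt (2 * r%:R / d%:R)) :> R.
Proof.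
move=> rd; have [->|[c cr]] := set_0Vmem (cyc r).
  by rewrite cards0 !mulr_ge0 ?sqrtr_ge0.
have := cr; rewrite inE => /andP[cA /asboolP[y yr ry]].
apply: (@card_root_of_unity_le R d K K0 algC y r (prim_order_gt0 yr) rd (prim_expr_order yr)).
  by move=> c'; rewrite inE => /andP[].
by move=> c' c'r; exact: cyc_root c'r yr.
Qed.

Lemma card_cyc2_le (R : realType) r : (r <= d)%N -> (1 < totient r)%N ->
  #|cyc r|%:R <= #|adm d K|%:R * (8 * r%:R / d%:R) :> R.
Proof.
move=> rd t1; have [->|[c cr]] := set_0Vmem (cyc r).
  by rewrite cards0 !mulr_ge0.
have := cr; rewrite inE => /andP[cA /asboolP[y yr ry]].
have [zs [gz yz sz zE rz]] := root_galois cA ry.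
apply: (@card_root_of_unity2_le R d K K0 algC y r (prim_order_gt0 yr) rd (prim_expr_order yr) zs) => //.
- by rewrite sz (minCpoly_cyclotomic yr) size_cyclotomic.
- by case: (r) t1 => [|[|r']].
- by move=> c'; rewrite inE => /andP[].
by move=> c' c'r; exact: cyc_root c'r yr.
Qed.

Lemma bad_cover m c : c \in bad m ->
  (exists2 n, (0 < n <= m)%N & c \in noncyc n) \/
  (exists r, [/\ (0 < r)%N, (0 < totient r <= m)%N & c \in cyc r]).
Proof.
rewrite inE => /andP[cA /asboolP[x rx xm]].
have [zs [gz xz sz zE rz]] := root_galois cA rx.
have [[k k0 xk]|nk] := pselect (exists2 k, (0 < k)%N & x ^+ k = 1).
  right; have [r rr rk] := prim_order_exists k0 xk.
  exists r; split; first exact: prim_order_gt0 rr.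
    rewrite totient_gt0 (prim_order_gt0 rr) /=.
    by move: xm; rewrite (minCpoly_cyclotomic rr) size_cyclotomic.
  by rewrite inE cA; apply/asboolP; exists x.
left; exists (size zs).
  by rewrite sz xm andbT; have := size_minCpoly x; case: (size _) => // [[]].
rewrite inE cA; apply/asboolP; exists zs; split=> // z zz k k0 zk.
apply: nk; exists k => //; case: gz => [[_ _ _ _ cj] _].
have rE y : root (toC ('X^k - 1)) y = (y ^+ k == 1).
  by rewrite rmorphB /= map_polyXn rmorph1 rootE !hornerE subr_eq0.
apply/eqP; rewrite -rE; apply: cj zz xz _; rewrite rE; exact/eqP.
Qed.

End BadSets.

(** * Counting the bad polynomials *)

Section CountBad.
Variables (R : realType) (a l d K m : nat).
Let B := (2 * a + 4)%N.
Hypotheses (a1 : (1 < a)%N) (K0 : (0 < K)%N) (ld : (2 ^ l <= d)%N) (dl : (d < 2 ^ l.+1)%N)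
  (md : (m ^ 2 * l ^ 4 <= 16 * d)%N) (lbig : (24 * 1024 * a * (12 + 2 * B) <= l)%N)
  (Kd : (K <= d ^ (a - 1))%N).

Local Notation A := (#|adm d K|).

Let d0 : (0 < d)%N. Proof. by apply: leq_trans ld; rewrite expn_gt0. Qed.

Lemma nd_le n : (n <= m)%N -> (n ^ 2 * l ^ 4 <= 16 * d)%N.
Proof. by move=> nm; apply: leq_trans md; rewrite leq_mul2r leq_exp2r // nm orbT. Qed.

Lemma card_noncyc_le n : (0 < n <= m)%N -> (#|noncyc d K n| * 2 ^ (B * l) <= 3 * l.+1 * A)%N.
Proof.
move=> /andP[n0 nm]; have nd := nd_le nm.
have [k [k0 kn kl]] := numeric_primes a1 n0 ld dl nd lbig.
have [ps [ups sps psP]] := primes_between kn k0.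
have [U [XU Ul Ub]] := numeric_levels a1 n0 ld dl nd lbig k0 kl.
apply: (@leq_trans (U.+1 * A)); last by rewrite leq_mul2r Ul orbT.
apply: (@card_noncyclotomic_le algC d K K0 d0 n (2 ^ k) (bits a l) U) => //.
- by move=> c; rewrite inE => /andP[].
- exact: (numeric_bits a1 dl lbig K0 Kd).
- move=> c; rewrite inE => /andP[_ /asboolP[zs [gz sz nu rz]]]; exists zs; split=> //.
  by apply: (mahler_ge_of_primes gz nu ups); rewrite sz.
- by move=> u uU; apply: numeric_level_bound => //; exact: Ub.
Qed.

Definition cycn n : {set {ffun 'I_d -> 'I_(K.*2.+1)}} :=
  \bigcup_(r < (2 * n ^ 2).+1 | totient r == n) cyc d K r.

Lemma card_bad_cover : (#|bad d K m| <= \sum_(i < m) (#|noncyc d K i.+1| + #|cycn i.+1|))%N.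
Proof.
apply: (@leq_trans (\sum_(i < m) #|noncyc d K i.+1 :|: cycn i.+1|)).
  apply: card_cover_le => c /(bad_cover d0)[[n /andP[n0 nm] cn]|[r [r0 /andP[t0 tm] cr]]].
    have im : (n.-1 < m)%N by rewrite prednK.
    by exists (Ordinal im); rewrite inE /= prednK // cn.
  have im : ((totient r).-1 < m)%N by rewrite prednK.
  exists (Ordinal im); rewrite inE /= prednK //; apply/orP; right.
  have rt : (r < (2 * totient r ^ 2).+1)%N by rewrite ltnS totient_sq_ge.
  by apply/bigcupP; exists (Ordinal rt).
by apply: leq_sum => i _; exact: leq_card_setU.
Qed.

Lemma card_cycn_le n (w : R) : 0 <= w -> (0 < n)%N ->
  (forall r, (r <= 2 * n ^ 2)%N -> totient r = n -> #|cyc d K r|%:R <= w) ->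
  #|cycn n|%:R <= 3 * n%:R ^+ 2 * w.
Proof.
move=> w0 n0 H.
have : (#|cycn n| <= \sum_(r < (2 * n ^ 2).+1 | totient r == n) #|cyc d K r|)%N.
  rewrite /cycn; elim/big_ind2: _ => [|S s S' s' Ss Ss'|//]; first by rewrite cards0.
  by apply: leq_trans (leq_card_setU _ _) _; exact: leq_add.
rewrite -(ler_nat R) => /le_trans; apply; rewrite natr_sum.
apply: (@le_trans _ _ (\sum_(r < (2 * n ^ 2).+1) w)).
  rewrite big_mkcond /=; apply: ler_sum => r _; case: ifP => // /eqP rn.
  by apply: H => //; rewrite -ltnS.
rewrite sumr_const card_ord -(mulr_natl w) ler_wpM2r // -natrX -natrM ler_nat.
have : (0 < n ^ 2)%N by rewrite expn_gt0 n0.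
lia.
Qed.

Lemma log_mul_le_d n : (n <= m)%N -> (24 * l * n <= d)%N.
Proof.
case: n => [|n] nm; first by rewrite muln0.
exact: n_le_d a1 ld (nd_le nm) lbig.
Qed.

Let l0 : (0 < l)%N. Proof. exact: l_gt0 a1 lbig. Qed.

Lemma m_le_d : (m <= d)%N.
Proof. by apply: leq_trans (log_mul_le_d (leqnn m)); rewrite leq_pmull // muln_gt0. Qed.

Let dR0 : 0 < d%:R :> R. Proof. by rewrite ltr0n. Qed.
Let KR0 : 0 < K%:R :> R. Proof. by rewrite ltr0n. Qed.
Let A0 : 0 <= A%:R :> R. Proof. by []. Qed.

Lemma card_cycn_exp_le n : (0 < n <= m)%N ->
  #|cycn n|%:R <= A%:R * (3 * n%:R ^+ 2 / (2 * K%:R) ^+ n) :> R.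
Proof.
move=> /andP[n0 nm].
have K2 : 0 < (2 * K%:R) ^+ n :> R by rewrite exprn_gt0 // mulr_gt0.
have -> : A%:R * (3 * n%:R ^+ 2 / (2 * K%:R) ^+ n) = 3 * n%:R ^+ 2 * (A%:R / (2 * K%:R) ^+ n) :> R.
  by ring.
have w0 : 0 <= A%:R / (2 * K%:R) ^+ n :> R by apply: divr_ge0 => //; exact: ltW.
apply: card_cycn_le => // r _ tr; rewrite ler_pdivlMr // -natrM -natrX -natrM ler_nat -tr.
by apply: card_cyc_exp_le => //; rewrite tr (leq_trans nm m_le_d).
Qed.

Lemma sum_noncyc_le :
  \sum_(i < m) #|noncyc d K i.+1|%:R <= A%:R / d%:R ^+ a :> R.
Proof.
have da : 0 < d%:R ^+ a :> R by rewrite exprn_gt0.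
rewrite ler_pdivlMr // -natr_sum -natrX -natrM ler_nat.
have B0 : (0 < 2 ^ (B * l))%N by rewrite expn_gt0.
rewrite -(leq_pmul2r B0) mulnAC.
apply: (@leq_trans ((m * (3 * l.+1 * A)) * d ^ a)).
  rewrite leq_mul2r; apply/orP; right; rewrite big_distrl /=.
  have -> : (m * (3 * l.+1 * A) = \sum_(i < m) (3 * l.+1 * A))%N by rewrite sum_nat_const card_ord.
  by apply: leq_sum => i _; apply: card_noncyc_le; rewrite /= ltn_ord.
have [->|m0] := posnP m; first by rewrite !mul0n.
have l1 : (3 * l.+1 <= d)%N.
  apply: leq_trans (log_mul_le_d m0); lia.
have -> : (m * (3 * l.+1 * A) * d ^ a = A * (m * (3 * l.+1) * d ^ a))%N by lia.
rewrite leq_mul2l; apply/orP; right.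
apply: (@leq_trans (d * d * d ^ a)).
  by rewrite leq_mul2r leq_mul ?orbT // m_le_d.
rewrite mulnn -expnD; apply: (@leq_trans ((2 ^ l.+1) ^ (2 + a))).
  by rewrite leq_exp2r ?(ltnW dl).
rewrite -expnM leq_exp2l // /B; nia.
Qed.

Lemma sum_sq_geom_le k : \sum_(i < k) (i.+1)%:R ^+ 2 / 2 ^+ i
   = 12 - (2 * k%:R ^+ 2 + 8 * k%:R + 12) / 2 ^+ k :> R.
Proof.
elim: k => [|k IH]; first by rewrite big_ord0 expr0; field.
rewrite big_ord_recr /= IH [2 ^+ k.+1]exprS -[k.+1%:R]natr1; field.
by rewrite expf_neq0.
Qed.

Lemma sum_initial_le k q (w : R) : 0 <= w ->
  \sum_(i < k) (if (i < q)%N then w else 0) <= q%:R * w.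
Proof.
move=> w0; suff -> : \sum_(i < k) (if (i < q)%N then w else 0) = (minn k q)%:R * w.
  by rewrite ler_wpM2r // ler_nat geq_minr.
elim: k => [|k IH]; first by rewrite big_ord0 min0n mul0r.
rewrite big_ord_recr /= IH; case: ltnP => kq.
  by rewrite !(minn_idPl _) ?(ltnW kq) // -natr1 mulrDl mul1r.
by rewrite addr0 !(minn_idPr _) // leqW.
Qed.

Lemma card_bad_le_inv_K : #|bad d K m|%:R <= A%:R * (19 / K%:R) :> R.
Proof.
have := card_bad_cover; rewrite -(ler_nat R) => /le_trans; apply.
rewrite natr_sum; under eq_bigr do rewrite natrD; rewrite big_split /=.
have H1 : \sum_(i < m) #|noncyc d K i.+1|%:R <= A%:R * (1 / K%:R) :> R.
  apply: le_trans sum_noncyc_le _; rewrite ler_wpM2l // div1r lef_pV2 ?posrE ?exprn_gt0 //.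
  by rewrite -natrX ler_nat (leq_trans Kd) // leq_pexp2l //; lia.
have H2 : \sum_(i < m) #|cycn i.+1|%:R <= A%:R * (18 / K%:R) :> R.
  apply: (@le_trans _ _ (\sum_(i < m) A%:R * (3 / (2 * K%:R) * (i.+1%:R ^+ 2 / 2 ^+ i)))).
    apply: ler_sum => i _; apply: le_trans (card_cycn_exp_le _) _; first by rewrite /= ltn_ord.
    rewrite ler_wpM2l // -mulrA.
    have -> : 3 / (2 * K%:R) * (i.+1%:R ^+ 2 / 2 ^+ i) = 3 * (i.+1%:R ^+ 2 / ((2 * K%:R) * 2 ^+ i)) :> R.
      by field; rewrite expf_neq0 ?gt_eqF.
    rewrite ler_wpM2l // ler_wpM2l ?exprn_ge0 // lef_pV2 ?posrE ?mulr_gt0 ?exprn_gt0 ?mulr_gt0 //.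
    rewrite exprS ler_wpM2l ?mulr_ge0 ?(ltW KR0) // lerXn2r ?nnegrE ?mulr_ge0 ?(ltW KR0) //.
    by rewrite ler_peMr // ler1n.
  rewrite -mulr_sumr ler_wpM2l // -mulr_sumr sum_sq_geom_le.
  have -> : 18 / K%:R = 3 / (2 * K%:R) * 12 :> R by field; rewrite gt_eqF.
  by rewrite ler_wpM2l ?divr_ge0 ?mulr_ge0 ?(ltW KR0) // gerBl divr_ge0 ?exprn_ge0 //.
by apply: le_trans (lerD H1 H2) _; rewrite -mulrDr ler_wpM2l // -mulrDl ler_wpM2r ?invr_ge0 ?(ltW KR0) //.
Qed.

Hypotheses (lbig1 : (150 * 1000 <= l)%N) (lbig2 : (l ^ 12 <= 2 ^ l)%N).

(** With l = log2 d: for n = 1 only r = 1 and r = 2 occur; the bound O(r/d) is used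
    for 1 < n <= 5l, and 2^-n, which is then O(d^-5), for n > 5l. *)
Lemma card_bad_le_inv_sqrt : #|bad d K m|%:R <= A%:R * (122 / Num.sqrt d%:R) :> R.
Proof.
set s := Num.sqrt (d%:R : R).
have s0 : 0 < s by rewrite sqrtr_gt0.
have s2 : s ^+ 2 = d%:R by rewrite sqr_sqrtr ?ler0n.
have s1 : 1 <= s by rewrite -[1]sqrtr1 ler_wsqrtr // ler1n.
have l6 : l%:R ^+ 6 <= s.
  rewrite -(@ler_pXn2r _ 2) ?nnegrE ?exprn_ge0 ?(ltW s0) // s2 -exprM -natrX ler_nat.
  exact: leq_trans ld.
have := card_bad_cover; rewrite -(ler_nat R) => /le_trans; apply.
rewrite natr_sum; under eq_bigr do rewrite natrD; rewrite big_split /=.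
have H1 : \sum_(i < m) #|noncyc d K i.+1|%:R <= A%:R * (1 / s) :> R.
  apply: le_trans sum_noncyc_le _; rewrite ler_wpM2l // div1r lef_pV2 ?posrE ?exprn_gt0 //.
  rewrite -s2 -exprM; apply: ler_eXnr => //; lia.
(* al bounds a term with n <= 5l, and be a term with n > 5l. *)
pose al : R := 48 * (5 * l%:R) ^+ 4 / d%:R.
pose be : R := 96 / d%:R ^+ 3.
have al0 : 0 <= al by rewrite divr_ge0 ?mulr_ge0 ?exprn_ge0 ?mulr_ge0.
have be0 : 0 <= be by rewrite divr_ge0 ?exprn_ge0.
have H2 (i : 'I_m) : #|cycn i.+1|%:R <= A%:R * ((if (i == 0%N :> nat) then 24 / s else 0) +
    (if (i < 5 * l)%N then al else 0) + be).
  have [i0|i0] := eqVneq (i : nat) 0%N.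
    have H : #|cycn 1|%:R <= 3 * 1%:R ^+ 2 * (A%:R * (4 * (2 / s))) :> R.
      apply: card_cycn_le => // [|r r2 _]; first by rewrite !mulr_ge0 ?invr_ge0 ?(ltW s0).
      have rd : (r <= d)%N.
        apply: leq_trans r2 _; apply: leq_trans (ltnW (l_le_d ld)).
        by apply: leq_trans (l_ge a1 lbig).2.
      apply: le_trans (card_cyc1_le K0 d0 R rd) _; rewrite ler_wpM2l // ler_wpM2l //.
      have -> : 2 / s = Num.sqrt (2 * 2 / d%:R).
        by rewrite -s2 -expr2 -expr_div_n sqrtr_sqr ger0_norm // divr_ge0 // ltW.
      rewrite ler_wsqrtr // ler_wpM2r ?invr_ge0 // ler_wpM2l // ler_nat; exact: r2.
    rewrite i0; apply: le_trans H _; rewrite expr1n mulr1 mulrCA ler_wpM2l //.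
    have al' : 0 <= (if (0 < 5 * l)%N then al else 0) by case: ifP.
    have -> : 3 * (4 * (2 / s)) = 24 / s by ring.
    by rewrite -addrA lerDl addr_ge0.
  rewrite add0r; have n1 : (1 < i.+1)%N by rewrite ltnS lt0n.
  have im : (0 < i.+1 <= m)%N by rewrite /= ltn_ord.
  case: ltnP => il.
    have id : (2 * i.+1 ^ 2 <= d)%N.
      apply: leq_trans ld; apply: leq_trans lbig2.
      apply: (@leq_trans (2 * (5 * l) ^ 2)); first by rewrite leq_mul2l leq_exp2r.
      rewrite expnMn mulnA (expnD l 2 10) mulnC leq_mul2l; apply/orP; right.
      have l50 : (50 <= l)%N by apply: leq_trans (l_ge a1 lbig).2.
      by apply: leq_trans l50 _; rewrite -{1}[l]expn1 leq_pexp2l.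
    have H : #|cycn i.+1|%:R <= 3 * i.+1%:R ^+ 2 * (A%:R * (16 * i.+1%:R ^+ 2 / d%:R)) :> R.
      have w0 : 0 <= A%:R * (16 * i.+1%:R ^+ 2 / d%:R) :> R.
        by rewrite mulr_ge0 // divr_ge0 // mulr_ge0 // exprn_ge0.
      apply: card_cycn_le => // r r2 tr.
      have rd : (r <= d)%N by exact: leq_trans r2 id.
      apply: le_trans (card_cyc2_le K0 d0 R rd _) _; first by rewrite tr.
      rewrite ler_wpM2l // ler_wpM2r ?invr_ge0 // -natrX -!natrM ler_nat.
      by rewrite -[16%N]/(8 * 2)%N -mulnA leq_mul2l r2 orbT.
    apply: le_trans H _; rewrite mulrCA ler_wpM2l // -[leLHS]addr0 lerD //.
    have -> : 3 * i.+1%:R ^+ 2 * (16 * i.+1%:R ^+ 2 / d%:R) = 48 * i.+1%:R ^+ 4 / d%:R :> R by ring.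
    rewrite /al ler_wpM2r ?invr_ge0 // ler_wpM2l // lerXn2r ?nnegrE ?mulr_ge0 //.
    by rewrite -natrM ler_nat.
  rewrite add0r; apply: le_trans (card_cycn_exp_le im) _; rewrite ler_wpM2l //.
  rewrite /be ler_pdivlMr ?exprn_gt0 // mulrAC ler_pdivrMr ?exprn_gt0 ?mulr_gt0 //.
  rewrite -(natrM R 2 K) -!natrX -!natrM ler_nat.
  apply: (@leq_trans (96 * 2 ^ (5 * l))); last first.
    rewrite leq_mul2l /=; apply: (@leq_trans (2 ^ i.+1)).
      by rewrite leq_exp2l // ltnW.
    by rewrite leq_exp2r // leq_pmulr.
  have idd : (i.+1 <= d)%N by apply: leq_trans (ltn_ord i) m_le_d.
  apply: (@leq_trans (3 * (d ^ 2 * d ^ 3))).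
    by rewrite -mulnA leq_mul2l leq_mul2r leq_exp2r // idd orbT.
  rewrite -expnD; apply: (@leq_trans (3 * (2 ^ l.+1) ^ 5)).
    by rewrite leq_mul2l leq_exp2r // ltnW.
  have -> : ((2 ^ l.+1) ^ 5 = 2 ^ 5 * 2 ^ (5 * l))%N.
    by rewrite -expnM -expnD mulnC mulnS.
  by rewrite mulnA leq_mul2r leqnn orbT.
have H3 : \sum_(i < m) #|cycn i.+1|%:R <= A%:R * (24 / s + (5 * l)%:R * al + m%:R * be).
  apply: le_trans (ler_sum _ (fun i _ => H2 i)) _.
  rewrite -mulr_sumr ler_wpM2l // !big_split /=; apply: lerD; first apply: lerD.
  - case: (m) => [|m']; first by rewrite big_ord0 divr_ge0 // ltW.
    by rewrite big_ord_recl /= big1 ?addr0.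
  - exact: sum_initial_le.
  - by rewrite sumr_const card_ord mulr_natl.
apply: le_trans (lerD H1 H3) _; rewrite -mulrDr ler_wpM2l //.
have B1 : (5 * l)%:R * al <= 1 / s.
  have l0R : 0 <= l%:R :> R by [].
  have -> : (5 * l)%:R * al = 150 * 1000 * l%:R ^+ 5 / s ^+ 2.
    by rewrite /al s2 natrM; field; rewrite gt_eqF.
  have -> : 1 / s = s / s ^+ 2 by field; rewrite gt_eqF.
  rewrite ler_wpM2r ?invr_ge0 ?exprn_ge0 ?(ltW s0) //; apply: le_trans l6.
  rewrite (exprS _ 5) ler_wpM2r ?exprn_ge0 //.
  by rewrite -natrM ler_nat.
have B2 : m%:R * be <= 96 / s.
  have -> : m%:R * be = 96 * (m%:R / d%:R ^+ 3) by rewrite /be; ring.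
  rewrite ler_wpM2l // ler_pdivrMr ?exprn_gt0 // mulrC ler_pdivlMr //.
  apply: (@le_trans _ _ (d%:R * d%:R)).
    apply: ler_pM => //; rewrite ?(ltW s0) //; first by rewrite ler_nat m_le_d.
    by rewrite -s2 expr2 ler_peMl ?(ltW s0).
  by rewrite -expr2 ler_weXn2l // ler1n.
have -> : 122 / s = 1 / s + (24 / s + 1 / s + 96 / s) by field; rewrite gt_eqF.
by rewrite lerD2l !lerD.
Qed.
End CountBad.

(** * Probability of a low-degree divisor *)

Local Open Scope classical_set_scope.
Local Open Scope ring_scope.

Lemma ln2_ge (R : realType) : 1 / 2 <= ln (2 : R).
Proof.
rewrite -ler_expR lnK ?posrE //.
have e0 : 0 < expR (1 / 2) :> R by exact: expR_gt0.
have : 1 - 1 / 2 <= expR (- (1 / 2)) :> R by exact: expR_ge1Dx.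
rewrite expRN -(ler_pM2r e0) mulVf ?gt_eqF //; lra.
Qed.

(** A version of m0^2 (log d)^4 = d with integers only; the factor 16 comes from
    ln d >= l / 2. *)
Lemma trunc_m0_le (R : realType) (d l : nat) : (0 < l)%N -> (2 ^ l <= d)%N ->
  ((Num.truncn (m0 R d)) ^ 2 * l ^ 4 <= 16 * d)%N.
Proof.
move=> l0 ld; have d0 : (0 < d)%N by apply: leq_trans ld; rewrite expn_gt0.
have lnd : l%:R / 2 <= ln (d%:R : R).
  apply: (@le_trans _ _ (ln ((2 : R) ^+ l))).
    rewrite lnXn // -(mulr_natl (ln 2)); apply: ler_wpM2l => //.
    by rewrite -div1r; exact: ln2_ge.
  by rewrite ler_ln ?posrE ?exprn_gt0 ?ltr0n // -natrX ler_nat.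
have l2 : 0 < l%:R / 2 :> R by rewrite divr_gt0 ?ltr0n.
have ln0 : 0 < ln (d%:R : R) by exact: lt_le_trans lnd.
have m0' : 0 <= m0 R d by rewrite /m0 divr_ge0 ?sqrtr_ge0 ?exprn_ge0 ?ltW.
set m := Num.truncn _.
have mm : m%:R <= m0 R d by rewrite truncn_le.
move: mm; rewrite /m0 ler_pdivlMr ?exprn_gt0 // => mm.
have ml : m%:R * (l%:R / 2) ^+ 2 <= Num.sqrt (d%:R : R).
  apply: le_trans mm; rewrite ler_wpM2l //.
  by rewrite lerXn2r ?nnegrE ?(ltW l2) ?(ltW ln0).
have : (m%:R * (l%:R / 2) ^+ 2) ^+ 2 <= (d%:R : R).
  rewrite -[leRHS]sqr_sqrtr ?ler0n //.
  by rewrite lerXn2r ?nnegrE ?sqrtr_ge0 ?mulr_ge0 ?exprn_ge0 ?(ltW l2).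
rewrite -(ler_nat R) natrM !natrX natrM.
have -> : (m%:R * (l%:R / 2) ^+ 2) ^+ 2 = m%:R ^+ 2 * l%:R ^+ 4 / 16%:R :> R by field.
by rewrite ler_pdivrMr // [d%:R * _]mulrC.
Qed.

Section Transfer.
Variables (disp : measure_display) (W : measurableType disp) (R : realType).
Variables (P : probability W R) (d K : nat) (f : W -> {poly int}).
Hypotheses (K0 : (0 < K)%N) (d0 : (0 < d)%N) (rf : random_poly P d K f).
Local Notation T := 'I_(K.*2.+1).

Lemma centre_inj : injective (@centre K).
Proof. by move=> v w; rewrite /centre => /addIr[] /val_inj. Qed.

Lemma allowedE (i : 'I_d) :
  allowed K i = [set centre v | v in [set v | v \in @adm_coef d K i]].
Proof.
apply/seteqP; split=> [v [vK v0]|_ [v vA <-]].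
  have vT : (absz (v + K%:Z)%R < K.*2.+1)%N by move: vK; lia.
  have vE : centre (Ordinal vT) = v by rewrite /centre /=; move: vK; lia.
  exists (Ordinal vT) => //; rewrite /= inE; apply/implyP => /eqP /v0.
  by apply: contraNneq => KE; rewrite -vE /centre KE subrr.
split; first exact: norm_centre_le.
move: vA => /=; rewrite inE => /implyP vA i0; rewrite /centre subr_eq0 eqz_nat.
by apply: vA; rewrite i0.
Qed.

Lemma card_allowed (i : 'I_d) : #|` fset_set (allowed K i)| = #|@adm_coef d K i|.
Proof.
rewrite allowedE fset_set_image; last exact: finite_finset.
rewrite card_imfset /=; last exact: centre_inj.
rewrite [RHS]cardE; apply/perm_size/uniq_perm; rewrite ?fset_uniq ?enum_uniq // => v.
rewrite mem_enum; transitivity (v \in [set` @adm_coef d K i]).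
  by apply: in_fset_set; exact: finite_finset.
by rewrite mem_setE.
Qed.

Lemma in_polyPdK w : exists2 c : {ffun 'I_d -> T}, c \in adm d K & f w = ffpoly c.
Proof.
case: rf => /(_ w)[fm [fs fa]] _ _ _.
have H (i : 'I_d) : exists2 v, v \in @adm_coef d K i & (f w)`_i = centre v.
  by have := fa i (ltn_ord i); rewrite allowedE => -[v vA vE]; exists v.
pose c := [ffun i => projT1 (cid2 (H i))].
have cP i : c i \in @adm_coef d K i /\ (f w)`_i = centre (c i).
  by rewrite ffunE; case: cid2.
exists c; first by rewrite inE; apply/familyP => i; exact: (cP i).1.
apply/polyP => j; have [jd|dj|->] := ltngtP j d.
- by rewrite (coef_ffpoly c (Ordinal jd)) -(cP (Ordinal jd)).2.
- by rewrite !nth_default ?size_ffpoly ?fs.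
- have := ffpoly_monic c; rewrite monicE lead_coefE size_ffpoly /= => /eqP ->.
  by move: fm; rewrite monicE lead_coefE fs => /eqP.
Qed.

Lemma divisor_bad (c : {ffun 'I_d -> T}) : c \in adm d K ->
  has_divisor_deg_le (m0 R d) (ffpoly c) -> c \in bad d K (Num.truncn (m0 R d)).
Proof.
move=> cA [g [g1 gm [q qE]]]; rewrite inE cA; apply/asboolP.
have g0 : g != 0 by apply: contraTneq g1 => ->; rewrite size_poly0.
have sg : size (map_poly (intr : int -> algC) g) = size g.
  by rewrite size_map_inj_poly //; exact: intr_inj.
have [x rx] : exists x, root (map_poly (intr : int -> algC) g) x.
  apply/closed_rootP; rewrite sg; apply: contraTneq g1 => ->; by [].
exists x; first by rewrite qE rmorphM rootM rx orbT.
have [p [pE pm] pP] := minCpolyP x.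
have gQ : map_poly (intr : int -> algC) g = map_poly ratr (map_poly intr g).
  by rewrite -map_poly_comp; apply: eq_map_poly => z /=; rewrite ratr_int.
have gQ0 : map_poly (intr : int -> rat) g != 0.
  by rewrite map_poly_eq0_id0 // intr_eq0 lead_coef_eq0.
have : p %| map_poly intr g by rewrite -pP -gQ.
move/(dvdp_leq gQ0); rewrite pE size_map_poly size_map_inj_poly //; last exact: intr_inj.
move=> pg; have m0' : 0 <= m0 R d by rewrite (le_trans _ gm).
rewrite truncn_ge_nat //; apply: le_trans gm; rewrite ler_nat.
by move: pg; case: (size p) => // k; case: (size g) => // k'; rewrite ltnS.
Qed.

(** By independence the vector of coefficients is uniform on [adm]. *)
Lemma measurable_eq_ffpoly (c : {ffun 'I_d -> T}) :
  measurable [set w | f w = ffpoly c] /\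
  (c \in adm d K -> P [set w | f w = ffpoly c] = ((#|adm d K|%:R)^-1)%:E).
Proof.
case: rf => fP fRV fI fU.
have E : [set w | f w = ffpoly c] =
    [set w | forall i, i \in [set: 'I_d]%SET -> [set centre (c i)] ((f w)`_i)].
  apply/seteqP; split=> w /= wc; first by move=> i _; rewrite wc coef_ffpoly.
  have [c' _ fc'] := in_polyPdK w; rewrite fc'; congr ffpoly; apply/ffunP => i.
  by apply: centre_inj; rewrite -!coef_ffpoly -fc' wc ?inE // coef_ffpoly.
split.
  rewrite E (_ : [set w | _] = \bigcap_(i in [set: 'I_d]) [set w | (f w)`_i = centre (c i)]).
    by apply: fin_bigcap_measurable => [|i _]; [exact: finite_finset|exact: (fRV i [set centre (c i)])].
  by apply/seteqP; split=> w /= wc i; [move=> _; apply: wc; rewrite inE|move=> _; exact: wc].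
move=> cA; rewrite E (fI [set: 'I_d]%SET (fun i => [set centre (c i)])).
rewrite (eq_bigr (fun i => ((#|@adm_coef d K i|%:R)^-1 : R)%:E)); last first.
  move=> i _; rewrite fU ?card_allowed //.
  by rewrite allowedE; exists (c i) => //; move: cA; rewrite inE => /familyP; apply.
rewrite prodEFin; congr (_%:E); rewrite prodfV card_adm natr_prod; congr (_^-1).
by apply: eq_bigl => i; rewrite inE.
Qed.

Lemma measure_bigsetU_le (I : Type) (s : seq I) (Q : pred I) (F : I -> set W) :
  (forall i, measurable (F i)) ->
  (P (\big[setU/set0]_(i <- s | Q i) F i) <= \sum_(i <- s | Q i) P (F i))%E.
Proof.
move=> mF; elim: s => [|i s IH]; first by rewrite !big_nil measure0.
rewrite !big_cons; case: ifP => // _.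
apply: le_trans (measureU2 _ _ _) _ => //; first exact: bigsetU_measurable.
by rewrite leeD2l.
Qed.

Lemma in_bigsetU (I : eqType) (s : seq I) (Q : pred I) (F : I -> set W) w :
  (\big[setU/set0]_(i <- s | Q i) F i) w <-> exists2 i, i \in s & Q i /\ F i w.
Proof.
elim: s => [|i s IH]; first by rewrite big_nil; split=> // -[].
rewrite big_cons; case: ifP => Qi.
  split=> [[Fi|/IH[j js Qj]]|[j]].
  - by exists i; rewrite ?mem_head.
  - by exists j; rewrite // in_cons js orbT.
  - rewrite in_cons => /orP[/eqP -> [_ Fi]|js Fj]; first by left.
    by right; apply/IH; exists j.
split=> [/IH[j js Qj]|[j]]; first by exists j; rewrite // in_cons js orbT.
rewrite in_cons => /orP[/eqP -> [Qi' _]|js Fj]; first by rewrite Qi in Qi'.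
by apply/IH; exists j.
Qed.

Lemma prob_divisor_le :
  (P [set w | has_divisor_deg_le (m0 R d) (f w)]
    <= (#|bad d K (Num.truncn (m0 R d))|%:R / #|adm d K|%:R : R)%:E)%E.
Proof.
set D := [set c in bad d K (Num.truncn (m0 R d)) |
   `[< has_divisor_deg_le (m0 R d) (ffpoly c) >]]%SET.
have -> : [set w | has_divisor_deg_le (m0 R d) (f w)] =
    \big[setU/set0]_(c in D) [set w | f w = ffpoly c].
  apply/seteqP; split=> w /=.
    move=> hw; have [c cA fc] := in_polyPdK w; apply/in_bigsetU; exists c => //=.
      by rewrite mem_index_enum.
    split=> //; rewrite inE divisor_bad -?fc //; exact/asboolP.
  by move/in_bigsetU => [c _ [cD ->]]; move: cD; rewrite inE => /andP[_ /asboolP].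
apply: le_trans (measure_bigsetU_le _ _ _) _; first by move=> c; exact: (measurable_eq_ffpoly c).1.
rewrite (eq_bigr (fun=> ((#|adm d K|%:R)^-1 : R)%:E)); last first.
  by move=> c; rewrite !inE => /andP[/andP[cA _] _]; rewrite (measurable_eq_ffpoly c).2 // inE.
rewrite sumEFin lee_fin sumr_const -[leLHS]mulr_natl ler_wpM2r ?invr_ge0 // ler_nat.
by apply: subset_leq_card; apply/fintype.subsetP => c; rewrite inE => /andP[].
Qed.

End Transfer.

Section Final.
Variable R : realType.

Lemma prob_le_of_card (disp : measure_display) (W : measurableType disp)
    (P : probability W R) (d K : nat) (f : W -> {poly int}) (w : R) :
  (0 < K)%N -> (0 < d)%N -> random_poly P d K f ->
  #|bad d K (Num.truncn (m0 R d))|%:R <= #|adm d K|%:R * w ->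
  (P [set x | has_divisor_deg_le (m0 R d) (f x)] <= w%:E)%E.
Proof.
move=> K0 d0 rf H; apply: le_trans (prob_divisor_le K0 d0 rf) _; rewrite lee_fin.
rewrite ler_pdivrMr 1?mulrC // ltr0n card_adm prodn_gt0 // => i.
by apply: leq_trans (card_adm_coef_ge K i); rewrite muln_gt0 K0.
Qed.

Definition large (a l : nat) :=
  (24 * 1024 * a * (12 + 2 * (2 * a + 4)) <= l)%N /\
  (150 * 1000 <= l)%N /\ (l ^ 12 <= 2 ^ l)%N.

Lemma near_large (a : nat) :
  \forall d \near \oo, (0 < trunc_log 2 d)%N /\ large a (trunc_log 2 d).
Proof.
rewrite /large; have [L HL] := exp_beats_poly 1 12.
set N1 := (24 * 1024 * a * _)%N; set N2 := (150 * 1000)%N.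
pose L' := maxn L (maxn N1 (maxn N2 1)).
exists (2 ^ L')%N => // d /= Ld; rewrite /large -/N1 -/N2.
have lL : (L' <= trunc_log 2 d)%N by apply: trunc_log_max.
have LL : (L <= L')%N by rewrite leq_maxl.
have H1 : (N1 <= L')%N by rewrite !leq_max leqnn orbT.
have H2 : (N2 <= L')%N by rewrite !leq_max leqnn !orbT.
have H3 : (1 <= L')%N by rewrite !leq_max leqnn !orbT.
split; first exact: leq_trans lL.
split; first exact: leq_trans lL.
split; first exact: leq_trans lL.
by rewrite -[X in (X <= _)%N]mul1n; apply: HL; exact: leq_trans lL.
Qed.

Lemma trunc_log_bounds d : (0 < d)%N -> (2 ^ trunc_log 2 d <= d < 2 ^ (trunc_log 2 d).+1)%N.
Proof. by move=> d0; rewrite trunc_logP // trunc_log_ltn. Qed.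

End Final.

Theorem theorem2p1 (R : realType) :
  (forall a : nat, (1 < a)%N ->
    exists C : R, 0 < C /\
      forall K : nat -> nat,
        (forall d : nat, (2 <= d)%N -> (0 < K d)%N) ->
        (\forall d \near \oo, (K d <= d ^ (a - 1))%N) ->
        \forall d \near \oo,
          forall (disp : measure_display) (T : measurableType disp)
                 (P : probability T R) (f : T -> {poly int}),
            random_poly P d (K d) f ->
            (P [set w | has_divisor_deg_le (m0 R d) (f w)] <=
               (C * Num.sqrt ((K d)%:R / d%:R))%:E)%E)
  /\
  (forall (c : R) (a : nat), 0 < c -> (1 < a)%N ->
    exists C : R, 0 < C /\
      forall K : nat -> nat,
        (forall d : nat, (2 <= d)%N -> (0 < K d)%N) ->
        (\forall d \near \oo,
           c * d%:R <= (K d)%:R /\ (K d <= d ^ (a - 1))%N) ->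
        \forall d \near \oo,
          forall (disp : measure_display) (T : measurableType disp)
                 (P : probability T R) (f : T -> {poly int}),
            random_poly P d (K d) f ->
            (P [set w | has_divisor_deg_le (m0 R d) (f w)] <=
               (C * (K d)%:R^-1)%:E)%E).
Proof.
split.
- move=> a a1; exists 122; split=> // K Kpos Kle.
  near=> d => disp T P f rf.
  have d2 : (2 <= d)%N by near: d; exact: nbhs_infty_ge.
  have d0 : (0 < d)%N by exact: leq_trans d2.
  have K0 := Kpos d d2.
  have Kd : (K d <= d ^ (a - 1))%N by near: d.
  have [l0 [l1 [l2 l3]]] : (0 < trunc_log 2 d)%N /\ large a (trunc_log 2 d).
    by near: d; exact: near_large.
  have /andP[ld dl] := trunc_log_bounds d0.
  have md := @trunc_m0_le R d _ l0 ld.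
  apply: (prob_le_of_card K0 d0 rf).
  apply: le_trans (card_bad_le_inv_sqrt R a1 K0 ld dl md l1 Kd l2 l3) _.
  rewrite ler_wpM2l // ler_wpM2l // -sqrtrV // ler_wsqrtr //.
  by rewrite ler_peMl ?invr_ge0 // ler1n.
- move=> c a c0 a1; exists 19; split=> // K Kpos Kle.
  near=> d => disp T P f rf.
  have d2 : (2 <= d)%N by near: d; exact: nbhs_infty_ge.
  have d0 : (0 < d)%N by exact: leq_trans d2.
  have K0 := Kpos d d2.
  have [_ Kd] : c * d%:R <= (K d)%:R /\ (K d <= d ^ (a - 1))%N by near: d.
  have [l0 [l1 _]] : (0 < trunc_log 2 d)%N /\ large a (trunc_log 2 d).
    by near: d; exact: near_large.
  have /andP[ld dl] := trunc_log_bounds d0.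
  have md := @trunc_m0_le R d _ l0 ld.
  apply: (prob_le_of_card K0 d0 rf).
  exact: (card_bad_le_inv_K R a1 K0 ld dl md l1 Kd).
Unshelve. all: by end_near.
Qed.
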